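(* Let $X$ be a compact Polish space and $A=C^*(X)$. There is an algorithm (an oracle Turing functional) which, given a name of a presentation $A^\#$ of $A$ and an $A^\#$-name of $\mathbf{1}_A$, computes a name of a presentation $X^\#$ of $X$ over which $A^\#$ is evaluative (relative to the given data), together with a total boundedness function for $X^\#$. Furthermore, if the algorithm is given names of the same presentation $A^\#$ (and of $\mathbf{1}_A$), the computed names refer to presentations of $X$ that are computably homeomorphic (relative to the given data) via the identity map.
   Context: For a compact Polish space $X$, $C^*(X)$ is the commutative unital $C^*$-algebra of continuous functions $X\to\mathbb{C}$ with the sup norm, pointwise operations and complex conjugation as involution; $\mathbf{1}_A$ is its unit. A presentation of a metric space $(M,d)$ is $M^\#=(M,(s_j))$ with $(s_j)$ dense; a presentation of $X$ is $X^\#=(X,d,(p_n))$ with $d$ a compatible metric. Its diagram is $\{(r,j,k,r'): r,r'\in\mathbb{Q},\ r<d(s_j,s_k)<r'\}$, and a name of $M^\#$ is an $f\in\mathbb{N}^\mathbb{N}$ whose range is exactly the set of codes $\langle r,j,k,r'\rangle$ of elements of the diagram. A name of a point $x$ is a sequence $(n_k)$ with $d(s_{n_k},x)<2^{-k}$; maps are computable if an oracle Turing machine transforms names of inputs to names of outputs. A total boundedness function of $M^\#$ is $f:\mathbb{N}\to\mathbb{N}$ such that $f(j)$ codes a finite $F\subseteq\mathbb{N}$ with $M=\bigcup_{k\in F}B(s_k;2^{-j})$. Fix an effective enumeration $(\mathfrak{p}_n)$ of the $*$-polynomials with coefficients in $\mathbb{Q}(i)$ in variables $x_0,x_1,\dots$.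 A presentation of a $C^*$-algebra $A$ is $A^\#=(A,(u_n))$ such that the rational vectors $\mathfrak{p}_n[A^\#]$ (substitute $u_j$ for $x_j$) are dense. Its diagram is $\{(r,j,r'): r,r'\in\mathbb{Q}\cap(0,\infty),\ r<\|\mathfrak{p}_j[A^\#]\|<r'\}$, and a name of $A^\#$ is $f\in\mathbb{N}^\mathbb{N}$ whose range is exactly the set of codes $\langle r,j,r'\rangle$ of elements of the diagram. An $A^\#$-name of $v\in A$ is a sequence $(m_k)$ with $\|\mathfrak{p}_{m_k}[A^\#]-v\|<2^{-k}$. Given $X^\#=(X,d_0,(p_n))$ and $C^*(X)^\#$ with rational vectors $(\rho_m)$, and a computable bijection $n\mapsto((n)_0,(n)_1)$ of $\mathbb{N}$ onto $\mathbb{N}^2$, $(C^*(X)\times X)^\#$ is the presented metric space with metric $\max\{\|u-v\|,d_0(p,q)\}$ and $n$-th distinguished point $(\rho_{(n)_0},p_{(n)_1})$. $C^*(X)^\#$ is evaluative over $X^\#$ if $(f,p)\mapsto f(p)$ is a computable map from $(C^*(X)\times X)^\#$ to $\mathbb{C}$ (for non-computable presentations, computability is relative to names of the presentations). *)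

(* Defs.v *)
From HB Require Import structures.
From Stdlib Require Cantor.
From mathcomp Require Import all_boot all_order all_algebra.
From mathcomp Require Import complex.
From mathcomp Require Import boolp classical_sets functions cardinality reals.
From mathcomp Require Import topology normedtype.

Set Implicit Arguments.
Unset Strict Implicit.
Unset Printing Implicit Defensive.

Import Order.TTheory GRing.Theory Num.Theory numFieldNormedType.Exports.

Local Open Scope classical_set_scope.
Local Open Scope ring_scope.

(** Oracle Turing functionals are represented by indices of Kleene's partial
    recursive functionals: closure of the basic functions and the oracle under
    pairing, composition, primitive recursion and unbounded search.  All
    functions are unary; several arguments are packed with the Cantor pairing
    [Cantor.to_nat : nat * nat -> nat], whose inverse is [Cantor.of_nat]. *)

Inductive functional : Type :=
| FZero
| FSucc
| FFst
| FSnd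
| FOracle
| FPair of functional & functional
| FComp of functional & functional
| FRec of functional & functional
| FMin of functional.

(** [feval O c x y]: on input [x] with oracle [O], the computation [c] halts
    with output [y].
    - [FRec a b] on [<x, n>] iterates [z |-> b <x, <i, z>>], [i = 0, ..., n-1],
      starting from [a x]; [s i] is the value after [i] steps.
    - [FMin a] on [x] returns the least [y] with [a <x, y> = 0], provided
      [a <x, i>] halts for every [i < y]. *)
Fixpoint feval (O : nat -> nat) (c : functional) (x y : nat) : Prop :=
  match c with
  | FZero => y = 0%N
  | FSucc => y = x.+1
  | FFst => y = (Cantor.of_nat x).1
  | FSnd => y = (Cantor.of_nat x).2
  | FOracle => y = O x
  | FPair a b => exists y1 y2,
      [/\ feval O a x y1, feval O b x y2 & y = Cantor.to_nat (y1, y2)]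
  | FComp a b => exists z, feval O b x z /\ feval O a z y
  | FRec a b => exists s : nat -> nat,
      [/\ feval O a (Cantor.of_nat x).1 (s 0%N),
          forall i, (i < (Cantor.of_nat x).2)%N ->
            feval O b
              (Cantor.to_nat ((Cantor.of_nat x).1, Cantor.to_nat (i, s i)))
              (s i.+1)
        & y = s (Cantor.of_nat x).2]
  | FMin a =>
      feval O a (Cantor.to_nat (x, y)) 0 /\
      forall i, (i < y)%N -> exists k, feval O a (Cantor.to_nat (x, i)) k.+1
  end.

Definition computes (c : functional) (O g : nat -> nat) : Prop :=
  forall n, feval O c n (g n).

(** Used to give several oracles to one functional, or to read off several
    outputs. *)
Definition join (f g : nat -> nat) : nat -> nat :=
  fun n => if odd n then g n./2 else f n./2.

Definition code_int (z : int) : nat :=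
  match z with Posz n => n.*2 | Negz n => n.*2.+1 end.

Definition int_of_nat (n : nat) : int :=
  if odd n then Negz n./2 else Posz n./2.

Definition code_rat (q : rat) : nat :=
  Cantor.to_nat (code_int (numq q), absz (denq q)).

Definition rat_of_nat (n : nat) : rat :=
  let: (a, b) := Cantor.of_nat n in (int_of_nat a)%:~R / b%:R.

Lemma code_ratK : cancel code_rat rat_of_nat.
Proof.
move=> q; rewrite /rat_of_nat /code_rat Cantor.cancel_of_to.
have -> : int_of_nat (code_int (numq q)) = numq q.
  by case: (numq q) => n; rewrite /int_of_nat /= odd_double /= ?uphalf_double
    ?doubleK.
by rewrite pmulrn absz_denq divq_num_den.
Qed.

Definition code3 (r : rat) (j : nat) (r' : rat) : nat :=
  Cantor.to_nat (code_rat r, Cantor.to_nat (j, code_rat r')).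

Definition code4 (r : rat) (j k : nat) (r' : rat) : nat :=
  Cantor.to_nat
    (code_rat r, Cantor.to_nat (j, Cantor.to_nat (k, code_rat r'))).

(** [(a, b)] stands for [a + b i]. *)
Definition qi : Type := (rat * rat)%type.

Definition qi_of_nat (n : nat) : qi :=
  let: (a, b) := Cantor.of_nat n in (rat_of_nat a, rat_of_nat b).

(** The letter [(j, false)] is the variable [x_j], and [(j, true)] is its
    adjoint.  A monomial is a nonempty word: as usual for C*-algebras that are
    not assumed to be unital, *-polynomials have no constant term (with constant
    terms the unit would be a rational vector, and a name of the unit would
    carry no information). *)
Definition letter : Type := (nat * bool)%type.
Definition monomial : Type := (letter * seq letter)%type.
Definition starpoly : Type := seq (qi * monomial).

Definition letter_of_nat (n : nat) : letter := (n./2, odd n).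

Definition monomial_of_nat (n : nat) : monomial :=
  let: (a, b) := Cantor.of_nat n in
  (letter_of_nat a, [seq letter_of_nat k | k <- CodeSeq.decode b]).

Definition term_of_nat (n : nat) : qi * monomial :=
  let: (a, b) := Cantor.of_nat n in (qi_of_nat a, monomial_of_nat b).

Definition starpoly_of_nat (n : nat) : starpoly :=
  [seq term_of_nat k | k <- CodeSeq.decode n].

Lemma seq_of_nat_surj (T : Type) (h : nat -> T) (code : T -> nat) :
  cancel code h ->
  cancel (fun s => CodeSeq.code (map code s))
         (fun n => map h (CodeSeq.decode n)).
Proof.
by move=> hK s; rewrite CodeSeq.codeK (mapK hK).
Qed.

Lemma starpoly_of_nat_surj (P : starpoly) : exists n, starpoly_of_nat n = P.
Proof.
pose cl (l : letter) := (l.2 + l.1.*2)%N.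
have clK : cancel cl letter_of_nat.
  case=> j b; rewrite /letter_of_nat /cl /= half_bit_double oddD odd_double.
  by rewrite addbF; case: b.
pose cm (m : monomial) :=
  Cantor.to_nat (cl m.1, CodeSeq.code (map cl m.2)).
have cmK : cancel cm monomial_of_nat.
  case=> l w; rewrite /monomial_of_nat /cm Cantor.cancel_of_to clK.
  by rewrite (seq_of_nat_surj clK).
pose ct (t : qi * monomial) :=
  Cantor.to_nat (Cantor.to_nat (code_rat t.1.1, code_rat t.1.2), cm t.2).
have ctK : cancel ct term_of_nat.
  case=> [[a b] m]; rewrite /term_of_nat /ct Cantor.cancel_of_to cmK.
  by rewrite /qi_of_nat Cantor.cancel_of_to !code_ratK.
by exists (CodeSeq.code (map ct P)); exact: (seq_of_nat_surj ctK).
Qed.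

Record presented (R : realType) := Presented {
  pt :> Type;
  mdistance : pt -> pt -> R;
  special : nat -> pt
}.

Section Presented.
Context {R : realType}.
Implicit Types M N : presented R.

Definition special_dense M : Prop :=
  forall (x : M) (e : R), 0 < e -> exists k, mdistance (special M k) x < e.

Definition metric_name M (f : nat -> nat) : Prop :=
  range f = [set n | exists r j k r',
    [/\ ratr r < mdistance (special M j) (special M k),
        mdistance (special M j) (special M k) < ratr r'
      & n = code4 r j k r']].

Definition point_name M (x : M) (w : nat -> nat) : Prop :=
  forall k, mdistance (special M (w k)) x < 2 ^- k.

(** [h j] codes the finite set of the members of [CodeSeq.decode (h j)]. *)
Definition total_boundedness_function M (h : nat -> nat) : Prop :=
  forall j (x : M), exists2 k,
    k \in CodeSeq.decode (h j) & mdistance (special M k) x < 2 ^- j.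

Definition computable_map (D : nat -> nat) M N (F : M -> N) : Prop :=
  exists c : functional, forall (x : M) (w : nat -> nat), point_name x w ->
    exists2 o, computes c (join D w) o & point_name (F x) o.

End Presented.

Definition complex_of_qi (R : realType) (q : qi) : R[i]^o :=
  Complex (ratr q.1) (ratr q.2).

Definition complex_plane (R : realType) : presented R :=
  Presented (fun z w : R[i]^o => Normc.normc (z - w))
    (fun n => complex_of_qi R (qi_of_nat n)).

Section Spaces.
Context {R : realType} (X : topologicalType).

Definition compatible_metric (d : X -> X -> R) : Prop :=
  [/\ forall x y, d x y = 0 <-> x = y,
      forall x y, d x y = d y x,
      forall x y z, d x z <= d x y + d y z
    & forall (x : X) (U : set X),
        nbhs x U <-> exists2 e, 0 < e & [set y | d x y < e] `<=` U].

Definition complete_metric (d : X -> X -> R) : Prop :=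
  forall s : nat -> X,
    (forall e, 0 < e -> exists N, forall m n,
       (N <= m)%N -> (N <= n)%N -> d (s m) (s n) < e) ->
    exists x : X, s @ \oo --> x.

Definition polish : Prop :=
  (exists2 S : set X, countable S & dense S) /\
  (exists2 d, compatible_metric d & complete_metric d).

Record space_presentation := SpacePresentation {
  sp_dist : X -> X -> R;
  sp_pts : nat -> X
}.

Definition space_of (P : space_presentation) : presented R :=
  Presented (sp_dist P) (sp_pts P).

Definition is_space_presentation (P : space_presentation) : Prop :=
  compatible_metric (sp_dist P) /\ special_dense (space_of P).

Definition computably_homeomorphic_id (D : nat -> nat)
    (P Q : space_presentation) : Prop :=
  computable_map D (M := space_of P) (N := space_of Q) (fun x => x) /\
  computable_map D (M := space_of Q) (N := space_of P) (fun x => x).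

End Spaces.

Arguments polish R X : clear implicits.
Arguments space_presentation R X : clear implicits.

Section Algebra.
Context {R : realType} (X : topologicalType).
Local Notation C := (R[i]^o).
Local Notation A := (continuousType X C).

Definition supnorm (f : X -> C) : R := sup (range (fun x => Normc.normc (f x))).

Implicit Type u : nat -> A.

Definition letter_eval u (l : letter) (x : X) : C :=
  if l.2 then conjc (u l.1 x) else u l.1 x.

Definition monomial_eval u (m : monomial) (x : X) : C :=
  \prod_(l <- m.1 :: m.2) letter_eval u l x.

Definition starpoly_eval u (P : starpoly) (x : X) : C :=
  \sum_(t <- P) complex_of_qi R t.1 * monomial_eval u t.2 x.

Lemma letter_eval_continuous u l : continuous (letter_eval u l).
Proof.
have uc j : continuous (u j) by exact: cts_fun.
rewrite /letter_eval; case: l.2; last exact: uc.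
move=> x; apply/cvgrPdist_lt => e e0.
have /cvgrPdist_lt/(_ e e0) := uc l.1 x.
by apply: filterS => t; rewrite -rmorphB normcJ.
Qed.

Lemma starpoly_eval_continuous u P : continuous (starpoly_eval u P).
Proof.
have mc m : continuous (monomial_eval u m).
  rewrite /monomial_eval; elim: (m.1 :: m.2) => [|l w IH] x.
    by under eq_fun do rewrite big_nil; exact: cvg_cst.
  under eq_fun do rewrite big_cons.
  apply: cvgM; first exact: letter_eval_continuous.
  exact: IH.
rewrite /starpoly_eval; elim: P => [|t P IH] x.
  by under eq_fun do rewrite big_nil; exact: cvg_cst.
under eq_fun do rewrite big_cons.
apply: cvgD; last exact: IH.
by apply: cvgM; [exact: cvg_cst|exact: mc].
Qed.

Definition rational_vector u (n : nat) : A :=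
  mkcts (@starpoly_eval_continuous u (starpoly_of_nat n)).

(** The metric space underlying [A] with the rational vectors as distinguished
    points; [u] presents [A] when these are dense, and an [A#]-name of a vector
    is a name of it as a point of this space. *)
Definition algebra_of u : presented R :=
  Presented (fun f g : A => supnorm (fun x => f x - g x)) (rational_vector u).

Definition is_algebra_presentation u : Prop := special_dense (algebra_of u).

Definition algebra_name u (f : nat -> nat) : Prop :=
  range f = [set n | exists r j r',
    [/\ 0 < r, 0 < r',
        ratr r < supnorm (rational_vector u j),
        supnorm (rational_vector u j) < ratr r'
      & n = code3 r j r']].

Definition algebra_one : A := cst 1.

Definition product_of u (P : space_presentation R X) : presented R :=
  Presented
    (fun v w : A * X => Num.max (supnorm (fun x => v.1 x - w.1 x))
                                (sp_dist P v.2 w.2))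
    (fun n => (rational_vector u (Cantor.of_nat n).1,
               sp_pts P (Cantor.of_nat n).2)).

Definition evaluative (D : nat -> nat) u (P : space_presentation R X) : Prop :=
  computable_map D (M := product_of u P) (N := complex_plane R)
    (fun v => v.1 v.2).

Definition input_names u (f e : nat -> nat) : Prop :=
  algebra_name u f /\ point_name (M := algebra_of u) algebra_one e.

End Algebra.

Arguments algebra_one R X : clear implicits.

(* Main.v *)
(** Write [rho_m] for the [m]-th rational vector.  Every entry [<r, a, r'>] of
    the name of the algebra certifies [0 < r < |rho_a| < r'] (sup norms), so its
    position [i] can serve as a state standing for the nonempty closed set
    [V_i = {x : |rho_a x| >= r}].  Everything that the algorithm needs to know
    about [X] is an existential statement about norms of rational vectors:

    - [|rho_k - q| < d] on [V_i] is certified by some [rho_b] with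
      [rho_a (rho_b - 1)] and [rho_b (rho_k - q)] of small norm; by Urysohn
      functions and density such a [rho_b] exists whenever [|rho_k - q| <= d/2]
      on the slightly larger set [{|rho_a| >= r/8}];
    - by the same certificates applied to [rho_a] itself one recognizes that
      [V_i'] is included in [V_i];
    - [V_i], for [i] in a finite list, cover [X] once [sum_i rho_(a_i)] is
      certifiably close to the unit and all [r_i] are small compared with the
      length of the list; partitions of unity show that fine covers of this
      kind exist.  Only here is the name of the unit needed.

    Searching again and again for a state [V_i'] inside the present one on which
    the next [rho_k] is known to a prescribed precision, one reaches from each
    state [n] a point [p_n] of [V_n] at which all [rho_k] are computable.  These
    points are dense, and [d(x, y) = sup_k 2^-k min(1, |c_k x - c_k y|)], with
    [c_k] the real and imaginary parts of the [rho_m], is a compatible metric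
    computable on them.  It depends on the presentation of the algebra only, so
    that the identity between two presentations of [X] obtained from two names
    is computed by a search for a sufficiently close point. *)

Require Import Defs.
From HB Require Import structures.
From Stdlib Require Cantor.
From mathcomp Require Import all_boot all_order all_algebra.
From mathcomp Require Import complex.
From mathcomp Require Import boolp classical_sets functions cardinality reals.
From mathcomp Require Import topology normedtype.
From mathcomp Require Import zify ring lra.

Import Order.TTheory GRing.Theory Num.Theory numFieldNormedType.Exports.

Set Implicit Arguments.
Unset Strict Implicit.
Unset Printing Implicit Defensive.

Local Open Scope classical_set_scope.
Local Open Scope ring_scope.

(** * Computability relative to an oracle *)

Definition pr (a b : nat) : nat := Cantor.to_nat (a, b).
Definition p1 (n : nat) : nat := (Cantor.of_nat n).1.
Definition p2 (n : nat) : nat := (Cantor.of_nat n).2.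

Lemma p1_pr a b : p1 (pr a b) = a.
Proof. by rewrite /p1 /pr Cantor.cancel_of_to. Qed.

Lemma p2_pr a b : p2 (pr a b) = b.
Proof. by rewrite /p2 /pr Cantor.cancel_of_to. Qed.

Lemma pr_p1p2 n : pr (p1 n) (p2 n) = n.
Proof. by rewrite /pr /p1 /p2 -surjective_pairing Cantor.cancel_to_of. Qed.

Definition prE := (p1_pr, p2_pr, pr_p1p2).

(* [F] is computed by one functional from all oracles satisfying [P]; what [P]
   promises about the oracle is what makes unbounded searches terminate. *)
Definition cmp (P : (nat -> nat) -> Prop) (F : (nat -> nat) -> nat -> nat) :=
  exists c, forall O, P O -> computes c O (F O).

Definition nrec (a : nat) (b : nat -> nat -> nat) (n : nat) : nat :=
  nat_rect (fun=> nat) a b n.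

Fixpoint fsubst (d c : functional) : functional :=
  match c with
  | FOracle => d
  | FPair a b => FPair (fsubst d a) (fsubst d b)
  | FComp a b => FComp (fsubst d a) (fsubst d b)
  | FRec a b => FRec (fsubst d a) (fsubst d b)
  | FMin a => FMin (fsubst d a)
  | c => c
  end.

Lemma feval_subst O O' d c x y :
  computes d O O' -> feval O' c x y -> feval O (fsubst d c) x y.
Proof.
move=> dO; elim: c x y => //=.
- by move=> x y ->; exact: dO.
- move=> a IHa b IHb x y [y1 [y2 [/IHa ? /IHb ? ->]]].
  by exists y1, y2.
- by move=> a IHa b IHb x y [z [/IHb ? /IHa ?]]; exists z.
- move=> a IHa b IHb x y [s [/IHa ? sb ->]].
  by exists s; split => // i /sb/IHb.
- move=> a IHa x y [/IHa ? sb]; split => // i /sb [k /IHa ?].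
  by exists k.
Qed.

Section Computability.
Local Open Scope nat_scope.
Variable P : (nat -> nat) -> Prop.
Notation cmp := (cmp P).
Implicit Types F G a b n : (nat -> nat) -> nat -> nat.

Lemma cmp_ext F G : (forall O x, P O -> F O x = G O x) -> cmp F -> cmp G.
Proof. by move=> FG [c cF]; exists c => O PO x; rewrite -FG //; exact: cF. Qed.

Lemma cmp_id : cmp (fun O x => x).
Proof.
exists (FPair FFst FSnd) => O _ x /=.
by exists (p1 x), (p2 x); split => //; exact/esym/pr_p1p2.
Qed.

Lemma cmp_comp F a : cmp F -> cmp a -> cmp (fun O x => F O (a O x)).
Proof.
move=> [c cF] [d da]; exists (FComp c d) => O PO x /=.
by exists (a O x); split; [exact: da|exact: cF].
Qed.

Lemma cmp_succ a : cmp a -> cmp (fun O x => (a O x).+1).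
Proof. by apply: (@cmp_comp (fun=> S)); exists FSucc. Qed.

Lemma cmp_p1 a : cmp a -> cmp (fun O x => p1 (a O x)).
Proof. by apply: (@cmp_comp (fun=> p1)); exists FFst. Qed.

Lemma cmp_p2 a : cmp a -> cmp (fun O x => p2 (a O x)).
Proof. by apply: (@cmp_comp (fun=> p2)); exists FSnd. Qed.

Lemma cmp_oracle a : cmp a -> cmp (fun O x => O (a O x)).
Proof. by apply: (@cmp_comp (fun O => O)); exists FOracle. Qed.

Lemma cmp_const k : cmp (fun O x => k).
Proof.
elim: k => [|k IH]; first by exists FZero.
exact: cmp_succ IH.
Qed.

Lemma cmp_pr a b : cmp a -> cmp b -> cmp (fun O x => pr (a O x) (b O x)).
Proof.
move=> [c ca] [d db]; exists (FPair c d) => O PO x /=.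
by exists (a O x), (b O x); split; [exact: ca|exact: db|].
Qed.

Lemma cmp_nrec a (b : (nat -> nat) -> nat -> nat -> nat -> nat) n :
  cmp a -> cmp (fun O z => b O (p1 z) (p1 (p2 z)) (p2 (p2 z))) -> cmp n ->
  cmp (fun O x => nrec (a O x) (b O x) (n O x)).
Proof.
move=> [c ca] [d db] cn.
apply: (@cmp_ext (fun O x => (fun z => nrec (a O (p1 z)) (b O (p1 z)) (p2 z))
   (pr x (n O x)))) => [O x _|]; first by rewrite !prE.
apply: (@cmp_comp (fun O z => nrec (a O (p1 z)) (b O (p1 z)) (p2 z))); last first.
  by apply: cmp_pr => //; exact: cmp_id.
exists (FRec c d) => O PO x /=.
exists (nrec (a O (p1 x)) (b O (p1 x))); split => // [|i _].
  exact: ca.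
by have := db _ PO (pr (p1 x) (pr i (nrec (a O (p1 x)) (b O (p1 x)) i)));
  rewrite !prE.
Qed.

Lemma cmp_min (chk : (nat -> nat) -> nat -> nat -> bool) F :
  cmp (fun O z => ~~ chk O (p1 z) (p2 z)) ->
  (forall O x, P O -> chk O x (F O x) /\
     forall i, i < F O x -> ~~ chk O x i) ->
  cmp F.
Proof.
move=> [c cc] cF; exists (FMin c) => O PO x /=.
have [Fx lt_Fx] := cF _ x PO; split.
  by have := cc _ PO (pr x (F O x)); rewrite !prE Fx.
move=> i /lt_Fx Ni; exists 0.
by have := cc _ PO (pr x i); rewrite !prE Ni.
Qed.

Lemma cmp_search (chk : (nat -> nat) -> nat -> nat -> bool) :
  cmp (fun O z => ~~ chk O (p1 z) (p2 z)) ->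
  (forall O x, P O -> exists y, chk O x y) ->
  exists2 F, cmp F & forall O x, P O -> chk O x (F O x).
Proof.
move=> cchk ex.
have [F FP] : {F : (nat -> nat) -> nat -> nat | forall O x, P O -> chk O x (F O x) /\
     forall i, i < F O x -> ~~ chk O x i}.
  (* The default 0 is reached only for oracles outside [P]; for the others a witness exists and the
     least one is returned. *)
  exists (fun O x => if pselect (exists y, chk O x y) is left e
    then ex_minn e else 0) => O x PO.
  case: pselect => [e|]; last by have := ex _ x PO.
  case: ex_minnP => m cm min; split => // i; rewrite ltnNge.
  by apply: contra => /min.
by exists F; [exact: cmp_min cchk FP|move=> O x PO; have [] := FP O x PO].
Qed.

Lemma cmp_comp1 (g : nat -> nat) a :
  cmp (fun O x => g x) -> cmp a -> cmp (fun O x => g (a O x)).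
Proof. exact: cmp_comp. Qed.

Lemma cmp_comp2 (g : (nat -> nat) -> nat -> nat -> nat) a b :
  cmp (fun O z => g O (p1 z) (p2 z)) -> cmp a -> cmp b ->
  cmp (fun O x => g O (a O x) (b O x)).
Proof.
move=> cg ca cb; have := cmp_comp cg (cmp_pr ca cb).
by apply: cmp_ext => O x _; rewrite !prE.
Qed.

Lemma cmp_comp3 (g : (nat -> nat) -> nat -> nat -> nat -> nat) a b c :
  cmp (fun O z => g O (p1 z) (p1 (p2 z)) (p2 (p2 z))) -> cmp a -> cmp b ->
  cmp c -> cmp (fun O x => g O (a O x) (b O x) (c O x)).
Proof.
move=> cg ca cb cc; have := cmp_comp cg (cmp_pr ca (cmp_pr cb cc)).
by apply: cmp_ext => O x _; rewrite !prE.
Qed.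

End Computability.

Create HintDb cmp.
#[global] Hint Resolve cmp_id cmp_const cmp_succ cmp_p1 cmp_p2 cmp_pr cmp_oracle : cmp.
Ltac cmp_auto := cbv beta; auto 100 with nocore cmp.

(** * Arithmetic, bounded quantifiers and loops over coded lists *)

Section Arith.
Local Open Scope nat_scope.
Variable P : (nat -> nat) -> Prop.
Notation cmp := (cmp P).
Implicit Types F G a b n : (nat -> nat) -> nat -> nat.

Lemma cmp_addn a b : cmp a -> cmp b -> cmp (fun O x => a O x + b O x).
Proof.
move=> ca cb; apply: (@cmp_ext _ (fun O x => nrec (a O x) (fun _ s => s.+1) (b O x))).
  by move=> O x _; elim: (b O x) => [|m /= ->]; rewrite ?addn0 ?addnS.
by apply: cmp_nrec; cmp_auto.
Qed.

Lemma cmp_predn a : cmp a -> cmp (fun O x => (a O x).-1).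
Proof.
move=> ca; apply: (@cmp_ext _ (fun O x => nrec 0 (fun i _ => i) (a O x))).
  by move=> O x _; case: (a O x).
by apply: cmp_nrec; cmp_auto.
Qed.
Hint Resolve cmp_addn cmp_predn : cmp.

Lemma cmp_subn a b : cmp a -> cmp b -> cmp (fun O x => a O x - b O x).
Proof.
move=> ca cb; apply: (@cmp_ext _ (fun O x => nrec (a O x) (fun _ s => s.-1) (b O x))).
  by move=> O x _; elim: (b O x) => [|m /= ->]; rewrite ?subn0 ?subnS.
by apply: cmp_nrec; cmp_auto.
Qed.

Lemma cmp_muln a b : cmp a -> cmp b -> cmp (fun O x => a O x * b O x).
Proof.
move=> ca cb.
apply: (@cmp_ext _ (fun O x => nrec 0 (fun _ s => a O x + s) (b O x))).
  by move=> O x _; elim: (b O x) => [|m /= ->]; rewrite ?muln0 ?mulnS.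
apply: (@cmp_nrec _ _ (fun O x _ s => a O x + s)); cmp_auto.
by apply: cmp_addn; cmp_auto; apply: (@cmp_comp _ a); cmp_auto.
Qed.
Hint Resolve cmp_subn cmp_muln : cmp.

Lemma cmp_expn k b : cmp b -> cmp (fun O x => k ^ b O x).
Proof.
move=> cb; apply: (@cmp_ext _ (fun O x => nrec 1 (fun _ s => k * s) (b O x))).
  by move=> O x _; elim: (b O x) => [|m /= ->]; rewrite ?expnS.
by apply: cmp_nrec; cmp_auto.
Qed.

Lemma cmp_double a : cmp a -> cmp (fun O x => (a O x).*2).
Proof.
move=> ca; apply: (@cmp_ext _ (fun O x => a O x + a O x)); cmp_auto.
by move=> O x _; rewrite addnn.
Qed.

Lemma cmp_eq0 a : cmp a -> cmp (fun O x => a O x == 0).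
Proof.
move=> ca; apply: (@cmp_ext _ (fun O x => 1 - a O x)); cmp_auto.
by move=> O x _; case: (a O x).
Qed.
Hint Resolve cmp_expn cmp_double cmp_eq0 : cmp.

Implicit Types p q : (nat -> nat) -> nat -> bool.

Lemma cmp_negb p : cmp (fun O x => p O x) -> cmp (fun O x => ~~ p O x).
Proof.
move=> cq; apply: (@cmp_ext _ (fun O x => 1 - p O x)); cmp_auto.
by move=> O x _; case: (p O x).
Qed.

Lemma cmp_andb p q : cmp (fun O x => p O x) -> cmp (fun O x => q O x) ->
  cmp (fun O x => p O x && q O x).
Proof.
move=> cp cq; apply: (@cmp_ext _ (fun O x => p O x * q O x)); cmp_auto.
by move=> O x _; case: (p O x); case: (q O x).
Qed.
Hint Resolve cmp_negb cmp_andb : cmp.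

Lemma cmp_orb p q : cmp (fun O x => p O x) -> cmp (fun O x => q O x) ->
  cmp (fun O x => p O x || q O x).
Proof.
move=> cp cq; apply: (@cmp_ext _ (fun O x => ~~ (~~ p O x && ~~ q O x))).
  by move=> O x _; case: (p O x); case: (q O x).
by cmp_auto.
Qed.

Lemma cmp_leq a b : cmp a -> cmp b -> cmp (fun O x => a O x <= b O x).
Proof. by move=> ca cb; apply: cmp_eq0; cmp_auto. Qed.
Hint Resolve cmp_orb cmp_leq : cmp.

Lemma cmp_eqn a b : cmp a -> cmp b -> cmp (fun O x => a O x == b O x).
Proof.
move=> ca cb; apply: (@cmp_ext _ (fun O x => (a O x <= b O x) && (b O x <= a O x))).
  by move=> O x _; rewrite -eqn_leq.
by cmp_auto.
Qed.

Lemma cmp_if p a b : cmp (fun O x => p O x) -> cmp a -> cmp b ->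
  cmp (fun O x => if p O x then a O x else b O x).
Proof.
move=> cp ca cb.
apply: (@cmp_ext _ (fun O x => p O x * a O x + ~~ p O x * b O x)); cmp_auto.
by move=> O x _; case: (p O x); rewrite ?mul1n ?mul0n ?addn0.
Qed.
Hint Resolve cmp_eqn cmp_if : cmp.

Lemma cmp_odd a : cmp a -> cmp (fun O x => odd (a O x)).
Proof.
move=> ca; apply: (@cmp_comp1 _ (fun y => odd y : nat) a) => //.
apply: (@cmp_ext _ (fun O x => nrec 0 (fun _ s => s == 0) x)).
  by move=> O x _; elim: x => //= n ->; case: (odd n).
by apply: cmp_nrec; cmp_auto.
Qed.
Hint Resolve cmp_odd : cmp.

Lemma cmp_half a : cmp a -> cmp (fun O x => (a O x)./2).
Proof.
move=> ca; apply: (@cmp_comp1 _ half a) => //.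
apply: (@cmp_ext _ (fun O x => nrec 0 (fun i s => s + odd i) x)).
  by move=> O x _; elim: x => //= n ->; rewrite uphalf_half addnC.
by apply: cmp_nrec; cmp_auto.
Qed.
Hint Resolve cmp_half : cmp.

Lemma cmp_foldl_iota (g : (nat -> nat) -> nat -> nat -> nat -> nat) a n :
  cmp (fun O z => g O (p1 z) (p2 (p2 z)) (p1 (p2 z))) -> cmp a -> cmp n ->
  cmp (fun O x => foldl (g O x) (a O x) (iota 0 (n O x))).
Proof.
move=> cg ca cn.
apply: (@cmp_ext _ (fun O x => nrec (a O x) (fun i s => g O x s i) (n O x))).
  move=> O x _; elim: (n O x) => // m IH.
  by rewrite -[in iota _ _]addn1 iotaD foldl_cat /= -IH.
exact: (@cmp_nrec _ _ (fun O x i s => g O x s i)).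
Qed.

Lemma cmp_all_iota (p : (nat -> nat) -> nat -> nat -> bool) n :
  cmp (fun O z => p O (p1 z) (p2 z)) -> cmp n ->
  cmp (fun O x => all (p O x) (iota 0 (n O x))).
Proof.
move=> cp cn.
apply: (@cmp_ext _ (fun O x =>
  foldl (fun s i => (0 < s) && p O x i : nat) 1 (iota 0 (n O x)))).
  move=> O x _; suff H : forall b : bool, foldl (fun s i => (0 < s) && p O x i : nat) b
      (iota 0 (n O x)) = b && all (p O x) (iota 0 (n O x)).
    by rewrite (H true).
  elim: (iota 0 (n O x)) => [|k l IH] b /=; first by rewrite andbT.
  by rewrite lt0b IH andbA.
apply: (@cmp_foldl_iota (fun O x s i => (0 < s) && p O x i)); cmp_auto.
apply: cmp_andb; cmp_auto.
by apply: (@cmp_comp2 _ (fun O x i => p O x i : nat)); cmp_auto.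
Qed.

Lemma cmp_has_iota (p : (nat -> nat) -> nat -> nat -> bool) n :
  cmp (fun O z => p O (p1 z) (p2 z)) -> cmp n ->
  cmp (fun O x => has (p O x) (iota 0 (n O x))).
Proof.
move=> cp cn; apply: (@cmp_ext _ (fun O x =>
  ~~ all (fun i => ~~ p O x i) (iota 0 (n O x)))).
  move=> O x _; rewrite -has_predC; congr nat_of_bool; apply: eq_has => i /=.
  by rewrite negbK.
by apply: cmp_negb; apply: (@cmp_all_iota (fun O x i => ~~ p O x i)); cmp_auto.
Qed.

(* The loop invariant: after [i] steps [<v, <r, s>>] stands for the call
   [CodeSeq.decode_rec v (m - i) r], the entries already produced having been
   folded into [s]. *)
Definition decode_step (g : nat -> nat -> nat) (m i st : nat) : nat :=
  let v := p1 st in let r := p1 (p2 st) in let s := p2 (p2 st) in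
  if r == 0 then pr 0 (pr (m - i).-1 (g s v))
  else if r == 1 then pr v.+1 (pr (m - i).-1 s)
  else pr v (pr r.-2 s).

(** [CodeSeq.decode_rec] recurses on a fuel that starts at [n.-1] and drops by one at each call, so
    [n.-1] steps exhaust it. The counter held at that moment is the last entry of the list, and it
    is folded in at the end. *)
Definition fold_code (g : nat -> nat -> nat) (a n : nat) : nat :=
  let st := nrec (pr 0 (pr n.-1 a)) (decode_step g n.-1) n.-1 in
  if n == 0 then a else g (p2 (p2 st)) (p1 st).

Lemma fold_codeE (g : nat -> nat -> nat) (a n : nat) :
  fold_code g a n = foldl g a (CodeSeq.decode n).
Proof.
case: n => // n; rewrite /fold_code /=.
suff inv i : i <= n ->
    let st := nrec (pr 0 (pr n a)) (decode_step g n) i in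
    foldl g (p2 (p2 st)) (CodeSeq.decode_rec (p1 st) (n - i) (p1 (p2 st))) =
    foldl g a (CodeSeq.decode_rec 0 n n).
  by have := inv n (leqnn n); rewrite subnn /= => <-.
elim: i => [|i IH] lein; first by rewrite /= !prE subn0.
rewrite -(IH (ltnW lein)) /=; set st := nrec _ _ i; rewrite {1 2 3}/decode_step.
have -> : (n - i) = (n - i.+1).+1 by rewrite subnSK.
by case: (p1 (p2 st)) => [|[|r]] /=; rewrite !prE.
Qed.

Lemma cmp_fold (g : (nat -> nat) -> nat -> nat -> nat -> nat) a n :
  cmp (fun O z => g O (p1 z) (p2 (p2 z)) (p1 (p2 z))) -> cmp a -> cmp n ->
  cmp (fun O x => foldl (g O x) (a O x) (CodeSeq.decode (n O x))).
Proof.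
move=> cg ca cn; apply: (@cmp_ext _ (fun O x => fold_code (g O x) (a O x) (n O x))).
  by move=> O x _; rewrite fold_codeE.
have cg' b c d : cmp b -> cmp c -> cmp d ->
    cmp (fun O x => g O (b O x) (c O x) (d O x)).
  move=> cb cc cd.
  exact: (@cmp_comp3 _ (fun O x i s => g O x s i) b d c).
have cst : cmp (fun O x => nrec (pr 0 (pr (n O x).-1 (a O x)))
    (decode_step (g O x) (n O x).-1) (n O x).-1).
  apply: (@cmp_nrec _ _ (fun O x => decode_step (g O x) (n O x).-1)); cmp_auto.
  have cn1 : cmp (fun O z => (n O (p1 z)).-1).
    by apply: cmp_predn; apply: (@cmp_comp _ n); cmp_auto.
  by rewrite /decode_step; cmp_auto.
by rewrite /fold_code; cmp_auto.
Qed.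

Lemma cmp_all_code (p : (nat -> nat) -> nat -> nat -> bool) n :
  cmp (fun O z => p O (p1 z) (p2 z)) -> cmp n ->
  cmp (fun O x => all (p O x) (CodeSeq.decode (n O x))).
Proof.
move=> cp cn.
apply: (@cmp_ext _ (fun O x =>
  foldl (fun s i => (0 < s) && p O x i : nat) 1 (CodeSeq.decode (n O x)))).
  move=> O x _; suff H : forall b : bool, foldl (fun s i => (0 < s) && p O x i : nat) b
      (CodeSeq.decode (n O x)) = b && all (p O x) (CodeSeq.decode (n O x)).
    by rewrite (H true).
  elim: (CodeSeq.decode (n O x)) => [|k l IH] b /=; first by rewrite andbT.
  by rewrite lt0b IH andbA.
apply: (@cmp_fold (fun O x s i => (0 < s) && p O x i)); cmp_auto.
apply: cmp_andb; cmp_auto.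
by apply: (@cmp_comp2 _ (fun O x i => p O x i : nat)); cmp_auto.
Qed.

Lemma cmp_size_code n : cmp n -> cmp (fun O x => size (CodeSeq.decode (n O x))).
Proof.
move=> cn.
apply: (@cmp_ext _ (fun O x => foldl (fun s _ => s.+1) 0 (CodeSeq.decode (n O x)))).
  move=> O x _; rewrite -[RHS]add0n.
  elim: (CodeSeq.decode _) 0 => [|k l IH] m /=; first by rewrite addn0.
  by rewrite IH addSnnS.
by apply: (@cmp_fold (fun O x s _ => s.+1)); cmp_auto.
Qed.

(** One step of the recursion behind [CodeSeq.code]: coded lists are extended by arithmetic
    alone. *)
Definition cons_code (k n : nat) : nat := 2 ^ k * n.*2.+1.

Lemma cons_codeE (k n : nat) : CodeSeq.decode (cons_code k n) = k :: CodeSeq.decode n.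
Proof. by rewrite -[n in LHS]CodeSeq.decodeK -[RHS]CodeSeq.codeK. Qed.

Lemma cmp_cons_code a n : cmp a -> cmp n -> cmp (fun O x => cons_code (a O x) (n O x)).
Proof. by move=> ca cn; rewrite /cons_code; cmp_auto. Qed.

End Arith.

#[global] Hint Resolve cmp_addn cmp_predn cmp_subn cmp_muln cmp_expn cmp_double
  cmp_eq0 cmp_negb cmp_andb cmp_orb cmp_leq cmp_eqn cmp_if cmp_odd cmp_half
  cmp_size_code cmp_cons_code : cmp.

(** Relativisation: a functional written for the oracle [G O] runs on [O] once its oracle calls are
    replaced by a program for [G]. The construction, which expects joined names as its oracle, can
    thus be run when these are packed inside a larger oracle. *)
Lemma cmp_subst (P Q : (nat -> nat) -> Prop) (G F : (nat -> nat) -> nat -> nat) :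
  cmp P G -> (forall O, P O -> Q (G O)) -> cmp Q F -> cmp P (fun O => F (G O)).
Proof.
move=> [d dG] PQ [c cF]; exists (fsubst d c) => O PO x.
by apply: (feval_subst (dG _ PO)); exact: cF (PQ _ PO) x.
Qed.

(** * Codes of rationals and of *-polynomials *)

(** A code is read as [(p - n) / d] with natural numbers [p], [n] and [d > 0], which turns rational
    arithmetic into arithmetic of naturals. A zero denominator, for which the quotient is 0, is
    normalised to [0 / 1]. *)
Definition rpos (m : nat) : nat :=
  if (p2 m == 0)%N then 0%N else if odd (p1 m) then 0%N else (p1 m)./2.
Definition rneg (m : nat) : nat :=
  if (p2 m == 0)%N then 0%N else if odd (p1 m) then (p1 m)./2.+1 else 0%N.
Definition rden (m : nat) : nat := if (p2 m == 0)%N then 1%N else p2 m.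

Lemma rden_gt0 m : (0 < rden m)%N.
Proof. by rewrite /rden; case: eqP => // /eqP; rewrite lt0n. Qed.

Lemma rden_neq0 m : (rden m)%:R != 0 :> rat.
Proof. by rewrite pnatr_eq0 -lt0n rden_gt0. Qed.

Lemma rat_of_natE m :
  rat_of_nat m = ((rpos m)%:R - (rneg m)%:R) / (rden m)%:R.
Proof.
rewrite /rat_of_nat /rpos /rneg /rden /p1 /p2.
case: (Cantor.of_nat m) => a b /=; case: eqP => [->|_].
  by rewrite invr0 mulr0 subrr mul0r.
by rewrite /int_of_nat; case: odd; rewrite ?NegzE ?subr0 ?sub0r // mulrNz.
Qed.

Definition mkrat (a b d : nat) : nat :=
  pr (if b <= a then (a - b).*2 else (b - a).*2.-1)%N d.

Lemma rat_of_nat_mk a b d : rat_of_nat (mkrat a b d) = (a%:R - b%:R) / d%:R.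
Proof.
rewrite /rat_of_nat /mkrat /pr Cantor.cancel_of_to; congr (_ / _).
case: leqP => [le_ba|lt_ab].
  by rewrite /int_of_nat odd_double doubleK -natrB.
have [k ->] : exists k, b = (a + k.+1)%N by exists (b - a).-1; lia.
rewrite addKn doubleS /= /int_of_nat /= odd_double /= uphalf_double NegzE.
by rewrite mulrNz natrD opprD addNKr.
Qed.

Definition radd m n : nat :=
  mkrat (rpos m * rden n + rpos n * rden m) (rneg m * rden n + rneg n * rden m)
        (rden m * rden n).
Definition ropp m : nat := mkrat (rneg m) (rpos m) (rden m).
Definition rmul m n : nat :=
  mkrat (rpos m * rpos n + rneg m * rneg n) (rpos m * rneg n + rneg m * rpos n)
        (rden m * rden n).
Definition rle m n : bool :=
  (rpos m * rden n + rneg n * rden m <= rpos n * rden m + rneg m * rden n)%N.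

Lemma raddE m n : rat_of_nat (radd m n) = rat_of_nat m + rat_of_nat n.
Proof.
rewrite rat_of_nat_mk !rat_of_natE !natrD !natrM.
by field; rewrite !rden_neq0.
Qed.

Lemma roppE m : rat_of_nat (ropp m) = - rat_of_nat m.
Proof. by rewrite rat_of_nat_mk !rat_of_natE -mulNr opprB. Qed.

Lemma rmulE m n : rat_of_nat (rmul m n) = rat_of_nat m * rat_of_nat n.
Proof.
rewrite rat_of_nat_mk !rat_of_natE !natrD !natrM.
by field; rewrite !rden_neq0.
Qed.

Lemma rleE m n : rle m n = (rat_of_nat m <= rat_of_nat n).
Proof.
rewrite !rat_of_natE ler_pdivlMr ?ltr0n ?rden_gt0 // mulrAC.
rewrite ler_pdivrMr ?ltr0n ?rden_gt0 // /rle -(ler_nat rat) !natrD !natrM.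
by rewrite !mulrBl lerBlDr addrAC lerBrDr.
Qed.

Lemma cmp_dvdn P a b : cmp P a -> cmp P b ->
  cmp P (fun O x => (a O x %| b O x)%N).
Proof.
move=> ca cb.
apply: (@cmp_ext _ (fun O x =>
  has (fun k => k * a O x == b O x)%N (iota 0 (b O x).+1))); last first.
  apply: (@cmp_has_iota _ (fun O x k => k * a O x == b O x)%N); cmp_auto.
  by apply: cmp_eqn; last apply: cmp_comp; cmp_auto;
    apply: cmp_muln; cmp_auto; apply: cmp_comp; cmp_auto.
move=> O x _; congr nat_of_bool; apply/hasP/dvdnP => [[k _ /eqP <-]|[k bE]].
  by exists k.
have [b0|b_gt0] := posnP (b O x).
  by exists 0%N; rewrite ?mem_iota ?b0.
exists k; last by rewrite bE.
rewrite mem_iota add0n ltnS bE leq_pmulr //.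
by move: b_gt0; rewrite bE muln_gt0 => /andP[].
Qed.
#[global] Hint Resolve cmp_dvdn : cmp.

(* Exactly the values of [code_rat]. *)
Definition canonical (m : nat) : bool :=
  (p2 m != 0)%N && coprime (rpos m + rneg m) (p2 m).

Lemma canonicalP m : canonical m -> code_rat (rat_of_nat m) = m.
Proof.
move=> /andP[m2]; rewrite /rpos /rneg (negPf m2) => co.
have co' : coprime `|int_of_nat (p1 m)| `|(p2 m)%:Z|.
  by rewrite absz_nat; move: co; rewrite /int_of_nat; case: odd;
    rewrite ?addn0 ?add0n.
have mE : rat_of_nat m = (int_of_nat (p1 m))%:~R / (p2 m)%:Z%:~R.
  by rewrite /rat_of_nat /p1 /p2; case: (Cantor.of_nat m).
rewrite -[RHS]pr_p1p2 /code_rat -/(pr _ _) mE coprimeq_num // coprimeq_den //.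
have -> : (p2 m)%:Z == 0 = false by apply/negbTE.
rewrite gtr0_sg ?mul1r; last by rewrite ltz_nat lt0n.
congr pr; rewrite /code_int /int_of_nat.
by have := odd_double_half (p1 m); case: (odd (p1 m)).
Qed.

Lemma canonical_code q : canonical (code_rat q).
Proof.
rewrite /canonical /rpos /rneg /code_rat.
rewrite -/(pr _ _) !prE absz_eq0 (negPf (denq_neq0 q)) /=.
have := coprime_num_den q; case: (numq q) => n /=.
  by rewrite odd_double doubleK /= addn0.
by rewrite odd_double /= uphalf_double.
Qed.

Section CmpRat.
Variable P : (nat -> nat) -> Prop.
Implicit Types a b c : (nat -> nat) -> nat -> nat.

Lemma cmp_rpos a : cmp P a -> cmp P (fun O x => rpos (a O x)).
Proof. by move=> ca; rewrite /rpos; cmp_auto. Qed.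
Lemma cmp_rneg a : cmp P a -> cmp P (fun O x => rneg (a O x)).
Proof. by move=> ca; rewrite /rneg; cmp_auto. Qed.
Lemma cmp_rden a : cmp P a -> cmp P (fun O x => rden (a O x)).
Proof. by move=> ca; rewrite /rden; cmp_auto. Qed.
Lemma cmp_mkrat a b c : cmp P a -> cmp P b -> cmp P c ->
  cmp P (fun O x => mkrat (a O x) (b O x) (c O x)).
Proof. by move=> *; rewrite /mkrat; cmp_auto. Qed.
Hint Resolve cmp_rpos cmp_rneg cmp_rden cmp_mkrat : cmp.
Lemma cmp_radd a b : cmp P a -> cmp P b -> cmp P (fun O x => radd (a O x) (b O x)).
Proof. by move=> *; rewrite /radd; cmp_auto. Qed.
Lemma cmp_rmul a b : cmp P a -> cmp P b -> cmp P (fun O x => rmul (a O x) (b O x)).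
Proof. by move=> *; rewrite /rmul; cmp_auto. Qed.
Lemma cmp_ropp a : cmp P a -> cmp P (fun O x => ropp (a O x)).
Proof. by move=> *; rewrite /ropp; cmp_auto. Qed.
Lemma cmp_rle a b : cmp P a -> cmp P b -> cmp P (fun O x => rle (a O x) (b O x)).
Proof. by move=> *; rewrite /rle; cmp_auto. Qed.

Lemma cmp_canonical a : cmp P a -> cmp P (fun O x => canonical (a O x)).
Proof.
move=> ca; apply: (@cmp_comp1 _ (fun m => canonical m : nat) a) => //.
apply: (@cmp_ext _ (fun O m => (p2 m != 0) && all (fun d => ~~ ((d %| rpos m + rneg m)
  && (d %| p2 m)) || (d == 1)) (iota 0 (p2 m).+1))%N).
  move=> O m _; rewrite /canonical; congr nat_of_bool.
  apply: andb_id2l => m2.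
  apply/allP/idP => [H|co d _].
    have := H (gcdn (rpos m + rneg m) (p2 m)).
    rewrite mem_iota add0n ltnS dvdn_gcdl dvdn_gcdr; apply.
    by apply: dvdn_leq; [rewrite lt0n|exact: dvdn_gcdr].
  by case: (boolP (_ && _)) => //; rewrite -dvdn_gcd (eqP co) dvdn1.
apply: cmp_andb; cmp_auto.
apply: (@cmp_all_iota _ (fun _ m d => ~~ ((d %| rpos m + rneg m)
  && (d %| p2 m)) || (d == 1))%N); cmp_auto.
Qed.

End CmpRat.
#[global] Hint Resolve cmp_radd cmp_rmul cmp_ropp cmp_rle cmp_canonical : cmp.

(** Any code of the value is allowed, in lowest terms or not, so that the arithmetic never has to
    reduce fractions. *)
Definition cmpQ (P : (nat -> nat) -> Prop) (F : (nat -> nat) -> nat -> rat) :=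
  exists2 c, cmp P c & forall O x, P O -> rat_of_nat (c O x) = F O x.

Section CmpQ.
Variable P : (nat -> nat) -> Prop.
Implicit Types F G : (nat -> nat) -> nat -> rat.

Lemma cmpQ_const q : cmpQ P (fun O x => q).
Proof. by exists (fun _ _ => code_rat q) => [|O x _]; [cmp_auto|exact: code_ratK]. Qed.

Lemma cmpQ_of a : cmp P a -> cmpQ P (fun O x => rat_of_nat (a O x)).
Proof. by move=> ca; exists a. Qed.

Lemma cmpQ_add F G : cmpQ P F -> cmpQ P G -> cmpQ P (fun O x => F O x + G O x).
Proof.
move=> [c cc cF] [d cd dG]; exists (fun O x => radd (c O x) (d O x)); cmp_auto.
by move=> O x PO; rewrite raddE cF // dG.
Qed.

Lemma cmpQ_mul F G : cmpQ P F -> cmpQ P G -> cmpQ P (fun O x => F O x * G O x).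
Proof.
move=> [c cc cF] [d cd dG]; exists (fun O x => rmul (c O x) (d O x)); cmp_auto.
by move=> O x PO; rewrite rmulE cF // dG.
Qed.

Lemma cmpQ_opp F : cmpQ P F -> cmpQ P (fun O x => - F O x).
Proof.
move=> [c cc cF]; exists (fun O x => ropp (c O x)); cmp_auto.
by move=> O x PO; rewrite roppE cF.
Qed.

Lemma cmpQ_nat a : cmp P a -> cmpQ P (fun O x => (a O x)%:R).
Proof.
move=> ca; exists (fun O x => mkrat (a O x) 0 1); first by rewrite /mkrat; cmp_auto.
by move=> O x _; rewrite rat_of_nat_mk subr0 divr1.
Qed.

Lemma cmpQ_exp2 a : cmp P a -> cmpQ P (fun O x => 2 ^- a O x).
Proof.
move=> ca; exists (fun O x => mkrat 1 0 (2 ^ a O x)); first by rewrite /mkrat; cmp_auto.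
by move=> O x _; rewrite rat_of_nat_mk subr0 natrX mul1r.
Qed.

Lemma cmp_leQ F G : cmpQ P F -> cmpQ P G -> cmp P (fun O x => F O x <= G O x).
Proof.
move=> [c cc cF] [d cd dG]; apply: (@cmp_ext _ (fun O x => rle (c O x) (d O x))); cmp_auto.
by move=> O x PO; rewrite rleE cF // dG.
Qed.

Lemma cmp_ltQ F G : cmpQ P F -> cmpQ P G -> cmp P (fun O x => F O x < G O x).
Proof.
move=> cF cG; apply: (@cmp_ext _ (fun O x => ~~ (G O x <= F O x))).
  by move=> O x _; rewrite ltNge.
by apply: cmp_negb; exact: cmp_leQ.
Qed.

End CmpQ.
#[global] Hint Resolve cmpQ_const cmpQ_of cmpQ_add cmpQ_mul cmpQ_opp cmpQ_nat
  cmpQ_exp2 cmp_leQ cmp_ltQ : cmp.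

(** * Arithmetic on codes of polynomials *)

Definition qmul m n : nat :=
  pr (radd (rmul (p1 m) (p1 n)) (ropp (rmul (p2 m) (p2 n))))
     (radd (rmul (p1 m) (p2 n)) (rmul (p2 m) (p1 n))).
Definition qopp m : nat := pr (ropp (p1 m)) (ropp (p2 m)).

(** The letters of [v] end up in reverse order, which is harmless because the algebra is
    commutative. *)
Definition word_cat (v w : nat) : nat :=
  foldl (fun s k => cons_code k s) w (CodeSeq.decode v).

Definition term_mul (t t' : nat) : nat :=
  pr (qmul (p1 t) (p1 t'))
     (pr (p1 (p2 t))
         (word_cat (p2 (p2 t)) (cons_code (p1 (p2 t')) (p2 (p2 t'))))).

(* Codes of [q * m + s] and of [m * n + s], for codes of *-polynomials. *)
Definition scale_add (q m s : nat) : nat :=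
  foldl (fun s t => cons_code (pr (qmul q (p1 t)) (p2 t)) s) s (CodeSeq.decode m).
Definition mul_add (m n s : nat) : nat :=
  foldl (fun s t => foldl (fun s t' => cons_code (term_mul t t') s) s
    (CodeSeq.decode n)) s (CodeSeq.decode m).

Section CmpPoly.
Variable P : (nat -> nat) -> Prop.
Implicit Types a b c : (nat -> nat) -> nat -> nat.

Lemma cmp_qmul a b : cmp P a -> cmp P b -> cmp P (fun O x => qmul (a O x) (b O x)).
Proof. by move=> *; rewrite /qmul; cmp_auto. Qed.
Lemma cmp_qopp a : cmp P a -> cmp P (fun O x => qopp (a O x)).
Proof. by move=> *; rewrite /qopp; cmp_auto. Qed.
Lemma cmp_word_cat a b : cmp P a -> cmp P b ->
  cmp P (fun O x => word_cat (a O x) (b O x)).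
Proof.
move=> *; rewrite /word_cat.
by apply: (@cmp_fold _ (fun O x s k => cons_code k s)); cmp_auto.
Qed.
Hint Resolve cmp_qmul cmp_qopp cmp_word_cat : cmp.
Lemma cmp_term_mul a b : cmp P a -> cmp P b ->
  cmp P (fun O x => term_mul (a O x) (b O x)).
Proof. by move=> *; rewrite /term_mul; cmp_auto. Qed.
Hint Resolve cmp_term_mul : cmp.

Lemma cmp_scale_add a b c : cmp P a -> cmp P b -> cmp P c ->
  cmp P (fun O x => scale_add (a O x) (b O x) (c O x)).
Proof.
apply: (@cmp_comp3 _ (fun _ => scale_add)); rewrite /scale_add.
by apply: (@cmp_fold _ (fun O x s t => cons_code (pr (qmul (p1 x) (p1 t)) (p2 t)) s));
  cmp_auto.
Qed.

Lemma cmp_mul_add a b c : cmp P a -> cmp P b -> cmp P c ->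
  cmp P (fun O x => mul_add (a O x) (b O x) (c O x)).
Proof.
apply: (@cmp_comp3 _ (fun _ => mul_add)); rewrite /mul_add.
apply: (@cmp_fold _ (fun O x s t => foldl (fun s t' => cons_code (term_mul t t') s) s
    (CodeSeq.decode (p1 (p2 x))))); cmp_auto.
by apply: (@cmp_fold _ (fun O z s t' => cons_code (term_mul (p1 (p2 z)) t') s)); cmp_auto.
Qed.

End CmpPoly.
#[global] Hint Resolve cmp_qmul cmp_qopp cmp_scale_add cmp_mul_add : cmp.

Section PolyEval.
Context {R : realType} (X : topologicalType).
Variable u : nat -> continuousType X (R[i]^o).

Definition qval (m : nat) : R[i] := complex_of_qi R (qi_of_nat m).

Lemma qvalE m :
  qval m = Complex (ratr (rat_of_nat (p1 m))) (ratr (rat_of_nat (p2 m))).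
Proof.
by rewrite /qval /complex_of_qi /qi_of_nat /p1 /p2; case: (Cantor.of_nat m).
Qed.

Lemma qval_mul m n : qval (qmul m n) = qval m * qval n.
Proof.
rewrite !qvalE /qmul !prE !(raddE, rmulE, roppE) !(rmorphD, rmorphM, rmorphN).
by rewrite [RHS]/GRing.mul.
Qed.

Lemma qval_opp m : qval (qopp m) = - qval m.
Proof. by rewrite !qvalE /qopp !prE !roppE !rmorphN. Qed.

Let lval (l : nat) (x : X) : R[i]^o := letter_eval u (letter_of_nat l) x.
Let wval (w : nat) (x : X) : R[i]^o := \prod_(l <- CodeSeq.decode w) lval l x.
Let tval (t : nat) (x : X) : R[i]^o :=
  (qval (p1 t) : R[i]^o) * (lval (p1 (p2 t)) x * wval (p2 (p2 t)) x).

Lemma rational_vectorE n x :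
  rational_vector u n x = \sum_(t <- CodeSeq.decode n) tval t x.
Proof.
rewrite -[LHS]/(starpoly_eval u (starpoly_of_nat n) x).
rewrite /starpoly_eval /starpoly_of_nat big_map.
apply: eq_bigr => t _; rewrite /term_of_nat /tval /p2.
rewrite [in p1 t]/p1; case: (Cantor.of_nat t) => a b /=; congr (_ * _).
rewrite /monomial_eval /monomial_of_nat /p1 /wval; case: (Cantor.of_nat b) => l w /=.
by rewrite big_cons big_map.
Qed.

Lemma wval_cons l w x : wval (cons_code l w) x = lval l x * wval w x.
Proof. by rewrite /wval cons_codeE big_cons. Qed.

Lemma wval_cat v w x : wval (word_cat v w) x = wval v x * wval w x.
Proof.
rewrite /word_cat {2}/wval; elim: (CodeSeq.decode v) w => [|l s IH] w /=.
  by rewrite big_nil mul1r.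
by rewrite IH wval_cons big_cons mulrCA mulrA.
Qed.

Lemma tval_mul t t' x : tval (term_mul t t') x = tval t x * tval t' x.
Proof.
rewrite /tval /term_mul !prE qval_mul wval_cat wval_cons.
by ring.
Qed.

Lemma rv_cons t n x :
  rational_vector u (cons_code t n) x = tval t x + rational_vector u n x.
Proof. by rewrite !rational_vectorE cons_codeE big_cons. Qed.

Lemma rv_nil x : rational_vector u 0 x = 0.
Proof. by rewrite rational_vectorE big_nil. Qed.

Lemma rv_scale_add q m s x : rational_vector u (scale_add q m s) x =
  ((qval q : R[i]^o) * rational_vector u m x : R[i]^o) + rational_vector u s x.
Proof.
rewrite /scale_add [rational_vector u m x]rational_vectorE.
elim: (CodeSeq.decode m) s => [|t l IH] s /=.
  by rewrite big_nil mulr0 add0r.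
rewrite IH rv_cons big_cons addrA mulrDr [X in _ = X + _]addrC; congr (_ + _ + _).
by rewrite /tval !prE qval_mul -mulrA.
Qed.

Lemma rv_mul_add m n s x : rational_vector u (mul_add m n s) x =
  (rational_vector u m x * rational_vector u n x : R[i]^o) + rational_vector u s x.
Proof.
rewrite /mul_add [rational_vector u m x]rational_vectorE.
elim: (CodeSeq.decode m) s => [|t l IH] s /=.
  by rewrite big_nil mul0r add0r.
rewrite IH big_cons mulrDl -addrA addrCA; congr (_ + _).
rewrite [rational_vector u n x]rational_vectorE.
elim: (CodeSeq.decode n) s {IH} => [|t' l' IH'] s /=.
  by rewrite big_nil mulr0 add0r.
by rewrite IH' rv_cons tval_mul big_cons addrA mulrDr [X in _ = X + _]addrC.
Qed.

Definition rho (n : nat) (x : X) : R[i] := rational_vector u n x.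

Lemma rho0 x : rho 0 x = 0.
Proof. exact: rv_nil. Qed.

Lemma rho_scale_add q m s x :
  rho (scale_add q m s) x = qval q * rho m x + rho s x.
Proof. exact: rv_scale_add. Qed.

Lemma rho_mul_add m n s x :
  rho (mul_add m n s) x = rho m x * rho n x + rho s x.
Proof. exact: rv_mul_add. Qed.

End PolyEval.

(** * Continuous functions on a compact space *)

Notation nrm := (@Normc.normc _).

Section Modulus.
Variable R : rcfType.
Implicit Types z w : R[i].

Lemma nrm_ge0 z : 0 <= nrm z.
Proof. by case: z => a b; exact: sqrtr_ge0. Qed.

Lemma nrm_norm z : `|z| = (nrm z)%:C%C.
Proof. by []. Qed.

Lemma nrm_triangle z w : nrm (z + w) <= nrm z + nrm w.
Proof. by rewrite -lecR rmorphD /= -!nrm_norm ler_normD. Qed.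

Lemma nrm0 : nrm (0 : R[i]) = 0.
Proof. by rewrite Normc.normc0. Qed.

Lemma nrmN z : nrm (- z) = nrm z.
Proof. by case: z => a b /=; rewrite !sqrrN. Qed.

Lemma nrmB z w : nrm (z - w) = nrm (w - z).
Proof. by rewrite -nrmN opprB. Qed.

Lemma nrm_triangleB z w t : nrm (z - t) <= nrm (z - w) + nrm (w - t).
Proof. by rewrite (le_trans _ (nrm_triangle _ _)) // addrA subrK. Qed.

Lemma nrm_ler_dist z w : `|nrm z - nrm w| <= nrm (z - w).
Proof.
rewrite ler_norml; apply/andP; split; last first.
  by rewrite lerBlDr (le_trans _ (nrm_triangle _ _)) // subrK.
by rewrite lerNl opprB lerBlDr nrmB (le_trans _ (nrm_triangle _ _)) // subrK.
Qed.

Lemma nrm_real (a : R) : nrm (a%:C)%C = `|a|.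
Proof. by rewrite /= expr0n addr0 sqrtr_sqr. Qed.

Lemma nrm_eq0 z : (nrm z == 0) = (z == 0).
Proof. by apply/eqP/eqP => [/Normc.eq0_normc//|->]; exact: nrm0. Qed.

Lemma nrm_gt0 z : (0 < nrm z) = (z != 0).
Proof. by rewrite lt_def nrm_ge0 andbT nrm_eq0. Qed.

Lemma nrm_Re z : `|complex.Re z| <= nrm z.
Proof.
case: z => a b /=.
by rewrite -sqrtr_sqr ler_sqrt ?lerDl ?sqr_ge0 // addr_ge0 ?sqr_ge0.
Qed.

Lemma nrm_Im z : `|complex.Im z| <= nrm z.
Proof.
case: z => a b /=.
by rewrite -sqrtr_sqr ler_sqrt ?lerDr ?sqr_ge0 // addr_ge0 ?sqr_ge0.
Qed.

Lemma nrm_ReIm z : nrm z <= `|complex.Re z| + `|complex.Im z|.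
Proof.
case: z => a b /=.
have <- : Num.sqrt ((`|a| + `|b|) ^+ 2) = `|a| + `|b|.
  by rewrite sqrtr_sqr ger0_norm ?addr_ge0.
rewrite ler_sqrt ?sqr_ge0 // sqrrD !real_normK ?num_real //.
by rewrite addrAC lerDl mulrn_wge0 // mulr_ge0.
Qed.

End Modulus.

Section Continuity.
Context {R : realType} (X : topologicalType).
Implicit Types F G : X -> R[i].

(** The norm of [R[i]] takes its values in [R[i]]; with the real modulus [nrm] and a real [e], all
    later estimates stay in [R], where linear arithmetic applies. *)
Definition ctsC F := forall x e, 0 < e -> nbhs x [set y | nrm (F x - F y) < e].

Lemma ctsCP F : continuous (F : X -> R[i]^o) <-> ctsC F.
Proof.
split=> [cF x e e0|cF x].
  have /cvgrPdist_lt/(_ (e%:C)%C) := cF x; rewrite ltcR => /(_ e0).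
  by apply: filterS => t; rewrite [X in (X < _)%R]nrm_norm ltcR.
apply/cvgrPdist_lt => e e0.
have e0' : 0 < nrm e by rewrite nrm_gt0 gt_eqF.
have eE : e = (nrm e)%:C%C by rewrite -nrm_norm gtr0_norm.
apply: filterS (cF x _ e0') => t.
by rewrite [X in _ -> X < _]nrm_norm [in X in _ -> X]eE ltcR.
Qed.

Lemma continuous_nrm F : ctsC F -> continuous (fun x => nrm (F x) : R).
Proof.
move=> cF x; apply/cvgrPdist_lt => e e0.
by apply: filterS (cF x _ e0) => t; exact/le_lt_trans/nrm_ler_dist.
Qed.

Lemma ctsC_real (g : X -> R) : continuous g -> ctsC (fun x => (g x)%:C%C).
Proof.
move=> cg x e e0; have /cvgrPdist_lt/(_ _ e0) := cg x.
by apply: filterS => t gt; rewrite /mkset -rmorphB nrm_real.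
Qed.

Lemma ctsC_cst (z : R[i]) : ctsC (fun=> z).
Proof. by apply/ctsCP => x; exact: cvg_cst. Qed.

Lemma ctsCB F G : ctsC F -> ctsC G -> ctsC (fun x => F x - G x).
Proof.
move=> /ctsCP cF /ctsCP cG; apply/ctsCP => x.
by apply: (@cvgB R[i] R[i]^o); [exact: cF|exact: cG].
Qed.

Lemma ctsCM F G : ctsC F -> ctsC G -> ctsC (fun x => F x * G x).
Proof.
move=> /ctsCP cF /ctsCP cG; apply/ctsCP => x.
by apply: (@cvgM R[i]); [exact: cF|exact: cG].
Qed.

Hypothesis X_compact : compact [set: X].

Lemma ctsC_bounded F : ctsC F ->
  exists2 M, 0 < M & forall x, nrm (F x) <= M.
Proof.
move=> /continuous_nrm cF.
have : compact ((fun x => nrm (F x) : R^o) @` [set: X]).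
  by apply: continuous_compact => //; exact: continuous_subspaceT.
move=> /compact_bounded[M [Mr MP]]; exists (`|M| + 1).
  by rewrite ltr_wpDl.
move=> x; have := MP (`|M| + 1).
rewrite (le_lt_trans (ler_norm M)) ?ltrDl // => /(_ isT _ (imageP _ _)).
by move=> /(_ x I); apply: le_trans; exact: (@ler_norm R).
Qed.

Lemma le_supnorm F x : ctsC F -> nrm (F x) <= supnorm F.
Proof.
move=> cF; have [M _ FM] := ctsC_bounded cF.
apply: ub_le_sup; last by exists x.
by exists M => _ [y _ <-].
Qed.

Lemma supnorm_gt F r : [set: X] !=set0 -> r < supnorm F -> exists x, r < nrm (F x).
Proof.
move=> [x0 _] /sup_gt [|_ [x _ <-] ?]; last by exists x.
by exists (nrm (F x0)); exists x0.
Qed.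

Lemma supnorm_le F c : [set: X] !=set0 -> (forall x, nrm (F x) <= c) ->
  supnorm F <= c.
Proof.
move=> [x0 _] Fc; apply: ge_sup => [|_ [x _ <-] //].
by exists (nrm (F x0)); exists x0.
Qed.

End Continuity.

(** * States and certificates *)

(* The entry [f i = <r, a, r'>] of a name of the algebra; the state [i] stands
   for the set [{x : |rho_a x| >= r}]. *)
Definition st_a (f : nat -> nat) i : nat := p1 (p2 (f i)).
Definition st_r (f : nat -> nat) i : rat := rat_of_nat (p1 (f i)).
Definition st_R (f : nat -> nat) i : rat := rat_of_nat (p2 (p2 (f i))).

Definition qrat (r : rat) : nat := pr (code_rat r) (code_rat 0).

Definition sub_code (m n : nat) : nat := scale_add (qrat (-1)) n m.

(* A code of [a * (k - q)]. *)
Definition mulsub_code (a k q : nat) : nat :=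
  scale_add (qopp q) a (mul_add a k 0).

(* [upper f W m c]: the data [f i], [i < W], witness that [rho_m] has norm less
   than [c].  As [f] says nothing about vectors of norm zero, [rho_m] is split
   as a sum of two vectors. *)
Definition upper f W m (c : rat) : bool :=
  has (fun i => has (fun j =>
    (st_a f j == sub_code m (st_a f i)) && (st_R f i + st_R f j <= c))
    (iota 0 W)) (iota 0 W).

(* [near f W i k q d]: witnesses that [|rho_k - q| < d] where
   [|rho_(st_a f i)| >= st_r f i]; there the auxiliary [rho_b] is close to 1. *)
Definition near f W i k q (d : rat) : bool :=
  has (fun b => upper f W (mulsub_code (st_a f i) b (qrat 1)) (st_r f i / 4)
             && upper f W (mulsub_code b k q) (3 / 4 * d)) (iota 0 W).

Lemma upper_mono f W W' m c : (W <= W')%N -> upper f W m c -> upper f W' m c.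
Proof.
rewrite /upper => le_W /hasP[n1]; rewrite mem_iota add0n => /leq_trans/(_ le_W) n1W.
move=> /hasP[j]; rewrite mem_iota add0n => /leq_trans/(_ le_W) jW ij.
apply/hasP; exists n1; rewrite ?mem_iota ?add0n //.
by apply/hasP; exists j; rewrite ?mem_iota ?add0n.
Qed.

Lemma near_mono f W W' i k q d : (W <= W')%N -> near f W i k q d -> near f W' i k q d.
Proof.
rewrite /near => le_W /hasP[b]; rewrite mem_iota add0n => /leq_trans/(_ le_W) bW.
move=> /andP[b1 b2]; apply/hasP; exists b; rewrite ?mem_iota ?add0n //.
by rewrite (upper_mono le_W b1) (upper_mono le_W b2).
Qed.

Lemma rat_between (R : realType) (x y : R) : x < y -> exists q : rat, x < ratr q < y.
Proof. by move=> /rat_in_itvoo[q]; rewrite in_itv /= => ?; exists q. Qed.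

Lemma code3E r j r' : code3 r j r' = pr (code_rat r) (pr j (code_rat r')).
Proof. by []. Qed.

Section Algorithm.
Context {R : realType} (X : topologicalType).
Hypothesis X_nonempty : [set: X] !=set0.
Hypothesis X_compact : compact [set: X].
Variable u : nat -> continuousType X (R[i]^o).
Hypothesis u_pres : is_algebra_presentation u.
Variable f : nat -> nat.
Hypothesis f_name : algebra_name u f.

Local Notation rho := (rho u).
Local Notation qval := (@qval R).
Local Notation toR := (@ratr R).

Lemma continuous_rho n : ctsC (rho n).
Proof. by apply/ctsCP => x; exact: (@cts_fun _ _ (rational_vector u n)). Qed.

Lemma dense_rho (F : X -> R[i]) e : ctsC F -> 0 < e ->
  exists k, forall x, nrm (rho k x - F x) < e.
Proof.
move=> cF e0; have /ctsCP cF' := cF.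
have [k kF] := u_pres (mkcts cF') e0.
exists k => x; apply: le_lt_trans kF.
apply: (@le_supnorm _ _ X_compact (fun x => rho k x - F x)).
exact: ctsCB (continuous_rho _) cF.
Qed.

Lemma state_spec i : [/\ 0 < st_r f i, 0 < st_R f i,
  toR (st_r f i) < supnorm (rho (st_a f i)) &
  supnorm (rho (st_a f i)) < toR (st_R f i)].
Proof.
have : range f (f i) by exists i.
rewrite f_name => -[r [j [r' [r0 r'0 rj jr' fi]]]].
by rewrite /st_r /st_R /st_a fi code3E !prE !code_ratK.
Qed.

Lemma state_exists m r r' : 0 < r -> toR r < supnorm (rho m) ->
  supnorm (rho m) < toR r' -> exists i, [/\ st_a f i = m, st_r f i = r & st_R f i = r'].
Proof.
move=> r0 rm mr'.
have : range f (code3 r m r').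
  rewrite f_name; exists r, m, r'; split => //.
  rewrite -(@ltr0q R); apply: lt_trans mr'; apply: le_lt_trans rm.
  by rewrite ler0q ltW.
case=> i _ fi; exists i; rewrite /st_a /st_r /st_R fi.
by rewrite code3E !prE !code_ratK.
Qed.

Lemma qval_qrat r : qval (qrat r) = (toR r)%:C%C.
Proof. by rewrite qvalE /qrat !prE !code_ratK rmorph0. Qed.

Lemma rho_sub m n x : rho (sub_code m n) x = rho m x - rho n x.
Proof.
by rewrite /sub_code rho_scale_add qval_qrat !rmorphN !rmorph1 addrC mulN1r.
Qed.

Lemma rho_mulsub a k q x :
  rho (mulsub_code a k q) x = rho a x * (rho k x - qval q).
Proof.
rewrite /mulsub_code rho_scale_add rho_mul_add rho0 addr0 qval_opp.
by rewrite mulrBr addrC mulNr [qval q * _]mulrC.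
Qed.

Lemma state_point i : exists x, toR (st_r f i) < nrm (rho (st_a f i) x).
Proof. by have [_ _ /(supnorm_gt X_nonempty)] := state_spec i. Qed.

Lemma state_upper i x : nrm (rho (st_a f i) x) < toR (st_R f i).
Proof.
have [_ _ _] := state_spec i; apply: le_lt_trans.
by apply: le_supnorm => //; exact: continuous_rho.
Qed.

Lemma upper_sound W m c x : upper f W m c -> nrm (rho m x) < toR c.
Proof.
rewrite /upper => /hasP[n1 _ /hasP[j _ /andP[/eqP am le_c]]].
have := state_upper j x; rewrite am rho_sub => lt_j; have lt_i := state_upper n1 x.
apply: lt_le_trans (_ : toR (st_R f n1 + st_R f j) <= _); last by rewrite ler_rat.
rewrite rmorphD /=; apply: le_lt_trans (ltrD lt_i lt_j).
by rewrite -[in leLHS](subrK (rho (st_a f n1) x) (rho m x)) addrC nrm_triangle.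
Qed.

(** A rational vector [rho_k] close to [F] and the difference [rho_m - rho_k] both have norm below
    [c / 2]. Neither vanishes at [x0], so both norms are positive and both vectors occur in the
    name. *)
Lemma upper_split (F : X -> R[i]) m c (c1 : R) x0 : ctsC F ->
  (forall x, nrm (F x) <= c1) -> (forall x, nrm (rho m x - F x) <= c1) ->
  c1 < toR c / 2 -> F x0 != 0 -> rho m x0 - F x0 != 0 ->
  exists W, upper f W m c.
Proof.
move=> cF F1 mF1 lt_c1 F0 mF0.
(* The first bound keeps both norms below [c / 2], the other two keep both vectors nonzero at
   [x0]. *)
pose e := Num.min ((toR c / 2 - c1) / 2) (Num.min (nrm (F x0)) (nrm (rho m x0 - F x0))).
have e0 : 0 < e by rewrite /e !lt_min !nrm_gt0 F0 mF0 !andbT divr_gt0 // subr_gt0.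
have [k kF] := dense_rho cF e0.
have e1 : e <= (toR c / 2 - c1) / 2 by rewrite ge_min lexx.
have e2 : e <= nrm (F x0) by rewrite !ge_min lexx !orbT.
have e3 : e <= nrm (rho m x0 - F x0) by rewrite !ge_min lexx !orbT.
have pos (G : X -> R[i]) n : ctsC G -> (forall x, nrm (rho n x - G x) < e) ->
    (forall x, nrm (G x) <= c1) -> e <= nrm (G x0) ->
    exists i, st_a f i = n /\ st_R f i <= c / 2.
  move=> cG nG G1 eG.
  have n0 : 0 < supnorm (rho n).
    apply: lt_le_trans (_ : nrm (rho n x0) <= _); last first.
      by apply: le_supnorm => //; exact: continuous_rho.
    rewrite -subr_gt0 in e0 *.
    have := nrm_ler_dist (rho n x0) (G x0).
    have := nG x0; rewrite ler_norml => h1 /andP[h2 _]; lra.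
  have nc : supnorm (rho n) < toR c / 2.
    apply: le_lt_trans (_ : c1 + e < _); last by lra.
    apply: supnorm_le => // x.
    rewrite -[rho n x](subrK (G x)) (le_trans (nrm_triangle _ _)) // addrC.
    by rewrite lerD // ltW.
  have [r /andP[r0 rn]] := rat_between n0.
  have [r' /andP[nr' r'c]] := rat_between nc.
  have [|n1 [ai ri Ri]] := state_exists _ rn nr'; first by rewrite -(@ltr0q R).
  exists n1; split => //; rewrite Ri -(@ler_rat R) ltW //.
  by rewrite rmorphM /= fmorphV /= ratr_nat.
have [n1 [ai Ri]] := pos F k cF kF F1 e2.
have [j [aj Rj]] : exists j, st_a f j = sub_code m k /\ st_R f j <= c / 2.
  apply: (pos (fun x => rho m x - F x)) => // [|x].
    exact: ctsCB (continuous_rho _) cF.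
  have -> : rho (sub_code m k) x - (rho m x - F x) = F x - rho k x.
    by rewrite rho_sub opprB addrC addrA subrK.
  by rewrite nrmB.
exists (maxn n1 j).+1; apply/hasP; exists n1.
  by rewrite mem_iota add0n ltnS leq_maxl.
apply/hasP; exists j; first by rewrite mem_iota add0n ltnS leq_maxr.
by rewrite ai aj eqxx /= [leRHS](splitr c) lerD.
Qed.

(** A nonzero [rho_m] is split into two equal halves, a zero one into approximations of the
    constants [c / 4] and [- c / 4]; in both cases the summands are nonzero. *)
Lemma upper_complete m c (c0 : R) : (forall x, nrm (rho m x) <= c0) ->
  c0 < toR c -> exists W, upper f W m c.
Proof.
move=> mc0 lt_c0; have [x1 _] := X_nonempty.
have c0_ge0 : 0 <= c0 by rewrite (le_trans _ (mc0 x1)) ?nrm_ge0.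
have [[x0 x0P]|allz] := pselect (exists x, rho m x != 0).
  have half_neq0 : (2^-1)%:C%C * rho m x0 != 0 :> R[i].
    by rewrite mulf_neq0 // -nrm_gt0 nrm_real normr_gt0 invr_eq0 pnatr_eq0.
  have halfB x : rho m x - (2^-1)%:C%C * rho m x = (2^-1)%:C%C * rho m x :> R[i].
    rewrite -[X in X - _]mul1r -mulrBl; congr (_ * _).
    rewrite -[1]/(1%:C%C) -rmorphB; congr (_%:C%C); lra.
  have half_le x : nrm ((2^-1)%:C%C * rho m x : R[i]) <= c0 / 2.
    by rewrite Normc.normcM nrm_real ger0_norm ?invr_ge0 // mulrC ler_wpM2r ?invr_ge0.
  apply: (@upper_split (fun x => (2^-1)%:C%C * rho m x) m c (c0 / 2) x0) => //.
  - exact: ctsCM (@ctsC_cst _ _ _) (@continuous_rho _).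
  - by move=> x; rewrite halfB.
  - by rewrite ltr_pM2r ?invr_gt0.
  - by rewrite halfB.
have mz x : rho m x = 0.
  by apply/eqP; apply: contrapT => /negP xz; apply: allz; exists x.
have c_gt0 : 0 < toR c by rewrite (le_lt_trans c0_ge0).
have c4 : 0 < toR c / 4 by rewrite divr_gt0.
apply: (@upper_split (fun x => (toR c / 4)%:C%C) m c (toR c / 4) x1) => //.
- exact: ctsC_cst.
- by move=> x; rewrite nrm_real gtr0_norm.
- by move=> x; rewrite mz sub0r nrmN nrm_real gtr0_norm.
- lra.
- by rewrite -nrm_gt0 nrm_real gtr0_norm.
- by rewrite mz sub0r oppr_eq0 -nrm_gt0 nrm_real gtr0_norm.
Qed.

(** From [|rho_a| >= r] and [|rho_a (rho_b - 1)| < r / 4] one gets [|rho_b - 1| < 1 / 4], hence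
    [|rho_b| >= 3 / 4]. Dividing [|rho_b (rho_k - q)| < 3 / 4 * d] by [|rho_b|] leaves a bound by
    [d]. *)
Lemma near_sound W i k q d x : near f W i k q d ->
  toR (st_r f i) <= nrm (rho (st_a f i) x) -> nrm (rho k x - qval q) < toR d.
Proof.
rewrite /near => /hasP[b _ /andP[/(@upper_sound _ _ _ x)]].
rewrite rho_mulsub Normc.normcM qval_qrat rmorph1 => h1.
move=> /(@upper_sound _ _ _ x); rewrite rho_mulsub Normc.normcM => h2 h3.
have [ri _ _ _] := state_spec i.
have ri0 : 0 < toR (st_r f i) by rewrite ltr0q.
have hb : nrm (rho b x - 1) < 4^-1.
  have r4 : toR (st_r f i / 4) = toR (st_r f i) * 4^-1.
    by rewrite rmorphM /= fmorphV /= ratr_nat.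
  rewrite -(ltr_pM2l ri0) -r4; apply: le_lt_trans h1.
  by rewrite ler_wpM2r ?nrm_ge0.
have hb1 : 3 / 4 <= nrm (rho b x).
  have := nrm_triangle (rho b x) (1 - rho b x).
  rewrite addrC subrK [X in _ + X]nrmB Normc.normc1; lra.
have hk := nrm_ge0 (rho k x - qval q).
rewrite -(@ltr_pM2l _ (3/4)) ?divr_gt0 //.
have -> : 3 / 4 * toR d = toR (3 / 4 * d) by rewrite !rmorphM /= fmorphV /= !ratr_nat.
by apply: le_lt_trans h2; rewrite ler_wpM2r.
Qed.

End Algorithm.

(** * Existence of certificates *)

Definition cover_code (f : nat -> nat) (m s : nat) : nat :=
  foldl (fun acc i => scale_add (qrat 1) (st_a f i) acc)
        (scale_add (qrat (-1)) m 0) (CodeSeq.decode s).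

Section Completeness.
Context {R : realType} (X : topologicalType).
Hypothesis X_nonempty : [set: X] !=set0.
Hypothesis X_compact : compact [set: X].
Variable dist : X -> X -> R.
Hypothesis dist_compat : compatible_metric dist.
Variable u : nat -> continuousType X (R[i]^o).
Hypothesis u_pres : is_algebra_presentation u.
Variable f : nat -> nat.
Hypothesis f_name : algebra_name u f.

Local Notation rho := (rho u).
Local Notation qval := (@qval R).
Local Notation toR := (@ratr R).

Lemma qval_dense (z : R[i]) e : 0 < e -> exists q, nrm (z - qval q) < e.
Proof.
case: z => a b e0.
have [q1 /andP[q1a q1b]] : exists q : rat, a - e / 2 < ratr q < a + e / 2.
  by apply: rat_between; rewrite ltrD2l; lra.
have [q2 /andP[q2a q2b]] : exists q : rat, b - e / 2 < ratr q < b + e / 2.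
  by apply: rat_between; rewrite ltrD2l; lra.
exists (pr (code_rat q1) (code_rat q2)); rewrite qvalE !prE !code_ratK.
apply: le_lt_trans (nrm_ReIm _) _; rewrite /=.
rewrite [ltRHS]splitr ltrD // ltr_norml; apply/andP; split; lra.
Qed.

(** With [D = d / 2], the function [theta = D / max(|rho_k - q|, D)] plays the role of a Urysohn
    function: it equals 1 wherever [|rho_k - q| <= D], in particular where [|rho_a| >= r / 8], and
    [theta * |rho_k - q| <= D] everywhere. The certificate is a rational vector [rho_b] close to
    [theta]. *)
Lemma near_complete i k q d : 0 < d ->
  (forall x, toR (st_r f i) / 8 <= nrm (rho (st_a f i) x) ->
     nrm (rho k x - qval q) <= toR d / 2) ->
  exists W, near f W i k q d.
Proof.
move=> d0 kq; pose D := toR d / 2; pose h x := nrm (rho k x - qval q).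
have D0 : 0 < D by rewrite divr_gt0 // ltr0q.
have [ri _ _ _] := state_spec f_name i.
have ri0 : 0 < toR (st_r f i) by rewrite ltr0q.
have ch : ctsC (fun x => rho k x - qval q).
  by apply: ctsCB; [exact: continuous_rho|exact: ctsC_cst].
have mx x : D <= Num.max (h x) D by rewrite le_max lexx orbT.
have mx0 x : 0 < Num.max (h x) D by exact: lt_le_trans (mx x).
pose theta x := D / Num.max (h x) D.
have ctheta : ctsC (fun x => (theta x)%:C%C).
  apply: ctsC_real => x; apply: (@cvgM R); first exact: cvg_cst.
  apply: (@cvgV R); first by rewrite gt_eqF.
  apply: (@continuous_max R X h (fun=> D)); last exact: cvg_cst.
  exact: continuous_nrm.
have theta01 x : 0 <= theta x <= 1.
  by rewrite /theta divr_ge0 ?(ltW D0) ?(ltW (mx0 x)) //= ler_pdivrMr // mul1r.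
have theta_h x : theta x * h x <= D.
  rewrite /theta mulrAC ler_pdivrMr // ler_wpM2l ?(ltW D0) //.
  by rewrite le_max lexx.
have [Ma Ma0 MaP] := ctsC_bounded X_compact (@continuous_rho _ _ u (st_a f i)).
have [Mk Mk0 MkP] := ctsC_bounded X_compact ch.
(* Replacing [theta] by [rho_b] costs at most [r / 16] in the first bound and [D / 4] in the second.
   The totals are [r / 8 + r / 16 < r / 4] and [D + D / 4 = 5 / 8 * d < 3 / 4 * d]. *)
pose e := Num.min (toR (st_r f i) / (16 * Ma)) (D / (4 * Mk)).
have e0 : 0 < e by rewrite lt_min; apply/andP; split; rewrite divr_gt0 // mulr_gt0.
have ea : Ma * e <= toR (st_r f i) / 16.
  by rewrite mulrC -ler_pdivlMr // -mulrA -invfM /e ge_min lexx.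
have ek : e * Mk <= D / 4.
  by rewrite -ler_pdivlMr // -mulrA -invfM /e ge_min lexx orbT.
have [b bP] := dense_rho X_compact u_pres ctheta e0.
have [W1 W1P] : exists W, upper f W (mulsub_code (st_a f i) b (qrat 1)) (st_r f i / 4).
  apply: (@upper_complete _ _ X_nonempty X_compact _ u_pres _ f_name _ _
    (toR (st_r f i) * 3 / 16)); last first.
    by rewrite rmorphM /= fmorphV /= ratr_nat; lra.
  move=> x; rewrite rho_mulsub Normc.normcM qval_qrat rmorph1.
  have tri := nrm_triangleB (rho b x) (theta x)%:C%C 1.
  have h1 : nrm ((theta x)%:C%C - 1 : R[i]) = 1 - theta x.
    rewrite -[X in _ - X]/(1%:C%C) -rmorphB nrm_real distrC ger0_norm //.
    by case/andP: (theta01 x) => _; rewrite subr_ge0.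
  have {}tri : nrm (rho b x - 1) <= e + (1 - theta x).
    by rewrite (le_trans tri) // h1 lerD2r ltW.
  apply: le_trans (ler_wpM2l (nrm_ge0 _) tri) _; rewrite mulrDr.
  have ha : nrm (rho (st_a f i) x) * e <= toR (st_r f i) / 16.
    by rewrite (le_trans _ ea) // ler_wpM2r // ltW.
  suff : nrm (rho (st_a f i) x) * (1 - theta x) <= toR (st_r f i) / 8 by lra.
  have [ge_r|lt_r] := lerP (toR (st_r f i) / 8) (nrm (rho (st_a f i) x)).
    have -> : theta x = 1.
      by rewrite /theta max_r ?divff ?gt_eqF // kq.
    by rewrite subrr mulr0 divr_ge0 // ltW.
  rewrite (le_trans _ (ltW lt_r)) // -[leRHS]mulr1 ler_wpM2l ?nrm_ge0 //.
  by case/andP: (theta01 x); lra.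
have [W2 W2P] : exists W, upper f W (mulsub_code b k q) (3 / 4 * d).
  apply: (@upper_complete _ _ X_nonempty X_compact _ u_pres _ f_name _ _
    (D + D / 4)); last first.
    rewrite !rmorphM /= fmorphV /= !ratr_nat.
    by have := D0; rewrite /D; lra.
  move=> x; rewrite rho_mulsub Normc.normcM.
  have /andP[t0 _] := theta01 x.
  have hb : nrm (rho b x) <= e + theta x.
    rewrite -[rho b x](subrK (theta x)%:C%C) (le_trans (nrm_triangle _ _)) //.
    by rewrite nrm_real (ger0_norm t0) lerD2r ltW.
  apply: le_trans (ler_wpM2r (nrm_ge0 _) hb) _; rewrite mulrDl [leLHS]addrC lerD //.
  by rewrite (le_trans _ ek) // ler_wpM2l // ltW.
exists (maxn b (maxn W1 W2)).+1; apply/hasP; exists b.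
  by rewrite mem_iota add0n ltnS leq_maxl.
by apply/andP; split; [apply: upper_mono W1P|apply: upper_mono W2P];
  rewrite ltnW // ltnS !leq_max leqnn !orbT.
Qed.

Lemma state_approx (F : X -> R[i]) x0 (r : rat) e : ctsC F -> 0 < r ->
  toR r < nrm (F x0) -> 0 < e ->
  exists i, st_r f i = r /\ forall x, nrm (rho (st_a f i) x - F x) < e.
Proof.
(* The second bound keeps [|rho_k x0|] above [r], so that the name has an entry with lower bound [r]
   for [rho_k]. *)
move=> cF r0 rF e0; pose e' := Num.min e (nrm (F x0) - toR r).
have e'0 : 0 < e' by rewrite lt_min e0 subr_gt0.
have [k kF] := dense_rho X_compact u_pres cF e'0.
have rk : toR r < supnorm (rational_vector u k).
  apply: lt_le_trans (_ : nrm (rho k x0) <= _); last first.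
    by apply: (@le_supnorm _ _ X_compact (rho k)); exact: continuous_rho.
  have := kF x0; rewrite lt_min => /andP[_ h1].
  have := nrm_ler_dist (rho k x0) (F x0); rewrite ler_norml => /andP[h2 _]; lra.
have [r' /andP[kr' _]] :=
  rat_between (ltr_pwDr (@ltr01 R) (lexx (supnorm (rational_vector u k)))).
have [i [ai ri _]] := state_exists f_name r0 rk kr'.
exists i; split => // x; rewrite ai; apply: lt_le_trans (kF x) _.
by rewrite ge_min lexx.
Qed.

Lemma dist_ge0 x y : 0 <= dist x y.
Proof.
have [d0 dC dT _] := dist_compat.
have := dT x y x; rewrite (d0 x x).2 // (dC y x); lra.
Qed.

Lemma dist_continuous x : continuous (dist x).
Proof.
have [_ dC dT dN] := dist_compat.
move=> y; apply/cvgrPdist_lt => e e0; apply/(dN y _); exists e => // z /= yz.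
rewrite ltr_norml; have := dT x y z; have := dT x z y; rewrite (dC z y).
by move=> h1 h2; apply/andP; split; lra.
Qed.

Definition tent x (e : R) y : R := Num.max 0 (e - dist x y).

Lemma tent_continuous x e : continuous (tent x e).
Proof.
move=> y; apply: (@continuous_max R X (fun=> 0) (fun y => e - dist x y)).
  exact: cvg_cst.
by apply: (@cvgB R R^o); [exact: cvg_cst|exact: dist_continuous].
Qed.

Lemma tent_ge0 x e y : 0 <= tent x e y.
Proof. by rewrite /tent le_max lexx. Qed.

Lemma tent_gt0 x e y : (0 < tent x e y) = (dist x y < e).
Proof. by rewrite /tent lt_max ltxx subr_gt0. Qed.

Lemma tent_center x e : 0 <= e -> tent x e x = e.
Proof.
by have [d0 _ _ _] := dist_compat; rewrite /tent (d0 x x).2 // subr0 => /max_r.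
Qed.

(** A tent at [x0] supported in [U] is approximated to within [r / 8]; where the approximation has
    modulus at least [r / 8], the tent is positive. *)
Lemma state_inside (x0 : X) (U : set X) : nbhs x0 U ->
  exists i, forall x, toR (st_r f i) / 8 <= nrm (rho (st_a f i) x) -> U x.
Proof.
have [_ _ _ dN] := dist_compat; move=> /dN[e e0 eU].
have [r /andP[r0 re]] := rat_between e0.
have [||||i [ri iP]] := @state_approx (fun x => (tent x0 e x)%:C%C) x0 r (toR r / 8).
- by apply: ctsC_real; exact: tent_continuous.
- by rewrite -(@ltr0q R).
- by rewrite nrm_real (tent_center _ (ltW e0)) gtr0_norm.
- by rewrite divr_gt0.
exists i => x; rewrite ri => rx; apply: eU => /=.
rewrite -tent_gt0; have := iP x.
have := nrm_ler_dist (rho (st_a f i) x) (tent x0 e x)%:C%C.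
by rewrite nrm_real (ger0_norm (tent_ge0 _ _ _)) ler_norml => /andP[_]; lra.
Qed.

Lemma rho_cover m s x : rho (cover_code f m s) x =
  \sum_(i <- CodeSeq.decode s) rho (st_a f i) x - rho m x.
Proof.
rewrite /cover_code.
have -> : forall n, rho (foldl (fun acc i => scale_add (qrat 1) (st_a f i) acc) n
    (CodeSeq.decode s)) x =
    \sum_(i <- CodeSeq.decode s) rho (st_a f i) x + rho n x.
  elim: (CodeSeq.decode s) => [|i l IH] n /=; first by rewrite big_nil add0r.
  rewrite IH rho_scale_add qval_qrat rmorph1 mul1r big_cons.
  by rewrite addrCA addrA.
by rewrite rho_scale_add rho0 addr0 qval_qrat !rmorphN !rmorph1 mulN1r.
Qed.

Lemma nrm_sum (I : Type) (l : seq I) (F : I -> R[i]) :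
  nrm (\sum_(i <- l) F i) <= \sum_(i <- l) nrm (F i).
Proof.
elim: l => [|i l IH]; first by rewrite !big_nil nrm0.
by rewrite !big_cons (le_trans (nrm_triangle _ _)) // lerD2l.
Qed.

(** If every [|rho_(a_i) x|] were below [r_i <= 1 / (2 N)], with [N] the length of the list, the sum
    would have modulus at most [1 / 2]. But it lies within [1 / 4] of [rho_m x], itself within
    [1 / 8] of 1, and [1 / 2 + 1 / 4 + 1 / 8 < 1]. *)
Lemma cover_sound W m s x : upper f W (cover_code f m s) (1 / 4) ->
  nrm (rho m x - 1) < 8^-1 ->
  all (fun i => st_r f i * (size (CodeSeq.decode s)).*2%:R <= 1) (CodeSeq.decode s) ->
  exists2 i, i \in CodeSeq.decode s & toR (st_r f i) <= nrm (rho (st_a f i) x).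
Proof.
move=> /(@upper_sound _ _ X_compact _ _ f_name _ _ _ x); rewrite rho_cover => h1 h2 /allP sr.
apply: contrapT => noi; set l := CodeSeq.decode s in h1 sr noi *.
have : nrm (\sum_(i <- l) rho (st_a f i) x) <= 1 / 2.
  apply: le_trans (nrm_sum _ _) _.
  have [l0|l_gt0] := posnP (size l); first by rewrite (size0nil l0) big_nil divr_ge0.
  apply: le_trans (_ : \sum_(i <- l) (size l).*2%:R^-1 <= _); last first.
    rewrite big_const_seq count_predT iter_addr addr0 -[leLHS]mulr_natr.
    rewrite -mul2n natrM invfM -mulrA mulVf ?pnatr_eq0 -?lt0n //.
    by rewrite mulr1 mul1r.
  rewrite big_seq [leRHS]big_seq; apply: ler_sum => i il.
  have := sr i il; rewrite -(@ler_rat R) rmorphM /= ratr_nat rmorph1 => ri.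
  apply: le_trans (_ : toR (st_r f i) <= _).
    by rewrite leNgt; apply/negP => lt_r; apply: noi; exists i => //; exact: ltW.
  by rewrite -[leRHS]mul1r ler_pdivlMr // ltr0n double_gt0.
move: h1; rewrite rmorphM /= rmorph1 fmorphV /= ratr_nat => h1.
have t1 := nrm_triangle (1 - rho m x) (rho m x).
have t2 := nrm_triangleB (rho m x) (\sum_(i <- l) rho (st_a f i) x) 0.
rewrite subrK Normc.normc1 nrmB in t1; rewrite !subr0 nrmB in t2.
lra.
Qed.

Lemma ctsC_sum (I : Type) (l : seq I) (F : I -> X -> R) :
  (forall i, continuous (F i)) -> continuous (fun x => \sum_(i <- l) F i x).
Proof.
move=> cF; elim: l => [|i l IH] x.
  by under eq_fun do rewrite big_nil; exact: cvg_cst.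
under eq_fun do rewrite big_cons.
by apply: (@cvgD R R^o); [exact: cF|exact: IH].
Qed.

(** Finitely many balls inside the sets [U x] cover the space, and normalised tents form a partition
    of unity [chi] subordinate to them. Each [chi x] is approximated by a state to within an eighth
    of its threshold, so that on the enlarged state [chi x] is positive and the point lies in the
    ball of [x]. *)
Lemma cover_complete (U : X -> set X) m : (forall x : X, nbhs x (U x)) ->
  (forall x, nrm (rho m x - 1) < 8^-1) ->
  exists s, [/\ exists W, upper f W (cover_code f m s) (1 / 4),
    all (fun i => st_r f i * (size (CodeSeq.decode s)).*2%:R <= 1) (CodeSeq.decode s)
  & forall i, i \in CodeSeq.decode s -> exists x, forall y,
      toR (st_r f i) / 8 <= nrm (rho (st_a f i) y) -> U x y].
Proof.
have [_ _ _ dN] := dist_compat.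
move=> nU m1; have [x0 _] := X_nonempty.
have /choice[eps epsP] x : exists e : R, 0 < e /\ [set y | dist x y < e] `<=` U x.
  by have /dN[e e0 eU] := nU x; exists e.
pose Y : ptopologicalType := HB.pack (Topological.sort X) (isPointed.Build _ x0).
have : @cover_compact Y [set: X] by rewrite -(@compact_cover Y).
move=> /(_ X setT (fun x => [set y | dist x y < eps x])).
case=> [x _|x _|D _ DP].
- rewrite openE => y /= yx; apply/dN; exists (eps x - dist x y); first by rewrite subr_gt0.
  move=> z /= yz; have [_ _ dT _] := dist_compat.
  by have := dT x y z; lra.
- exists x => //=; have [d0 _ _ _] := dist_compat.
  by rewrite (d0 x x).2 //; case: (epsP x).
pose l := finmap.enum_fset D.
have lP y : exists2 x, x \in l & dist x y < eps x.
  by have [x xD xy] := DP y I; exists x.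
pose S y := \sum_(x <- l) tent x (eps x) y.
have cS : continuous S by apply: ctsC_sum => x; exact: tent_continuous.
have S0 y : 0 < S y.
  have [x xl xy] := lP y; rewrite /S (big_rem x) //=.
  by rewrite ltr_pwDl ?tent_gt0 // sumr_ge0 // => z _; exact: tent_ge0.
have l_gt0 : (0 < size l)%N by have [x xl _] := lP x0; case: (l) xl.
have N0 : 0 < (size l)%:R :> R by rewrite ltr0n.
pose chi x y := tent x (eps x) y / S y.
have cchi x : continuous (chi x).
  move=> y; apply: (@cvgM R); first exact: tent_continuous.
  by apply: (@cvgV R); [rewrite gt_eqF|exact: cS].
have chi0 x : 0 < chi x x.
  have [ex _] := epsP x.
  by rewrite divr_gt0 // tent_center // ltW.
(* A threshold below [chi x x] makes the state exist. With [N] the number of balls, a threshold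
   below [1 / (16 N)] is small enough for the size test, and the [N] errors of an eighth of it add
   up to at most [1 / 128], so the sum stays within [1 / 8 + 1 / 128 < 1 / 4] of [rho_m]. *)
have /choice[r rP] x : exists r : rat,
    0 < r /\ toR r < Num.min (chi x x) ((size l)%:R^-1 / 16).
  have [|r /andP[r0 rc]] := @rat_between R 0 (Num.min (chi x x) ((size l)%:R^-1 / 16)).
    by rewrite lt_min chi0 divr_gt0 // invr_gt0.
  by exists r; rewrite -(@ltr0q R).
have /choice[g gP] x : exists i, st_r f i = r x /\
    forall y, nrm (rho (st_a f i) y - (chi x y)%:C%C) < toR (r x) / 8.
  have [r0 rc] := rP x; apply: (@state_approx _ x) => //.
  - by apply: ctsC_real; exact: cchi.
  - move: rc; rewrite lt_min => /andP[rc _].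
    by rewrite nrm_real gtr0_norm.
  - by rewrite divr_gt0 // ltr0q.
exists (CodeSeq.code (map g l)); rewrite CodeSeq.codeK.
have rN x : toR (r x) < (size l)%:R^-1 / 16.
  by have [_] := rP x; rewrite lt_min => /andP[].
split.
- apply: (@upper_complete _ _ X_nonempty X_compact _ u_pres _ f_name _ _
    (8^-1 + 128^-1)); last first.
    by rewrite rmorphM /= rmorph1 fmorphV /= ratr_nat; lra.
  move=> y; rewrite rho_cover CodeSeq.codeK big_map.
  have chi1 : \sum_(x <- l) ((chi x y)%:C%C : R[i]) = 1.
    rewrite -(raddf_sum (real_complex R)) /= /chi -mulr_suml divff ?gt_eqF //.
    exact: S0.
  apply: le_trans (nrm_triangleB _ 1 _) _; rewrite addrC lerD //.
    by rewrite nrmB ltW.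
  rewrite -chi1 -sumrB (le_trans (nrm_sum _ _)) //.
  apply: le_trans (_ : \sum_(x <- l) ((size l)%:R^-1 / 128) <= _).
    apply: ler_sum => x _; have [_ gx] := gP x.
    by have := gx y; have := rN x; lra.
  rewrite big_const_seq count_predT iter_addr addr0 -[leLHS]mulr_natr.
  rewrite mulrAC mulVf ?gt_eqF //.
  by rewrite mul1r.
- apply/allP => _ /mapP[x _ ->]; have [-> _] := gP x; rewrite size_map.
  rewrite -(@ler_rat R) rmorphM /= ratr_nat rmorph1.
  rewrite -ler_pdivlMr ?ltr0n ?double_gt0 // mul1r -mul2n natrM invfM.
  have := rN x; have : 0 < (size l)%:R^-1 :> R by rewrite invr_gt0.
  lra.
- move=> _ /mapP[x _ ->]; exists x => y; have [-> gx] := gP x => h1.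
  have [_ +] := epsP x; apply => /=; rewrite -tent_gt0.
  have : 0 < chi x y.
    have := gx y; have := nrm_ler_dist (rho (st_a f (g x)) y) (chi x y)%:C%C.
    have chi_ge0 : 0 <= chi x y by rewrite divr_ge0 ?tent_ge0 ?(ltW (S0 _)).
    by rewrite nrm_real (ger0_norm chi_ge0) ler_norml => /andP[_]; lra.
  by rewrite /chi pmulr_lgt0 // invr_gt0.
Qed.

End Completeness.

(** * The metric *)

Section Metric.
Context {R : realType} (X : topologicalType).
Variable u : nat -> continuousType X (R[i]^o).
Local Notation rho := (rho u).
Local Notation toR := (@ratr R).

Definition coord (k : nat) (x : X) : R :=
  if odd k then complex.Im (rho k./2 x) else complex.Re (rho k./2 x).

Definition dist_term (x y : X) (k : nat) : R :=
  2 ^- k * Num.min 1 `|coord k x - coord k y|.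

Definition dist_rho (x y : X) : R := sup (range (dist_term x y)).

Lemma exp2_gt0 k : 0 < 2 ^- k :> R.
Proof. by rewrite invr_gt0 exprn_gt0. Qed.

Lemma exp2_le (k n : nat) : (k <= n)%N -> 2 ^- n <= 2 ^- k :> R.
Proof. by move=> kn; rewrite lef_pV2 ?posrE ?exprn_gt0 // ler_eXn2l // ltr1n. Qed.

Lemma exp2S k : 2 ^- k.+1 = 2 ^- k / 2 :> R.
Proof. by rewrite exprSr invfM. Qed.

Lemma exp2_small (e : R) : 0 < e -> exists n, 2 ^- n < e.
Proof.
move=> e0; exists (Num.bound e^-1); rewrite invf_plt ?posrE ?exprn_gt0 //.
exact: upper_nthrootP (leqnn _).
Qed.

Lemma dist_term_ge0 x y k : 0 <= dist_term x y k.
Proof. by rewrite mulr_ge0 ?(ltW (exp2_gt0 k)) // le_min ler01 normr_ge0. Qed.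

Lemma dist_term_le x y k : dist_term x y k <= 2 ^- k.
Proof. by rewrite /dist_term ler_piMr ?(ltW (exp2_gt0 k)) // ge_min lexx. Qed.

Lemma dist_term_coord x y k : dist_term x y k <= 2 ^- k * `|coord k x - coord k y|.
Proof. by rewrite ler_wpM2l ?(ltW (exp2_gt0 k)) // ge_min lexx orbT. Qed.

Lemma le_dist_rho x y k : dist_term x y k <= dist_rho x y.
Proof.
apply: ub_le_sup; last by exists k.
exists 1 => _ [n _ <-]; apply: le_trans (dist_term_le _ _ _) _.
by rewrite invf_le1 ?exprn_gt0 // exprn_ege1 // ler1n.
Qed.

Lemma dist_rho_le x y c : (forall k, dist_term x y k <= c) -> dist_rho x y <= c.
Proof.
move=> dc; apply: ge_sup => [|_ [k _ <-] //].
by exists (dist_term x y 0); exists 0%N.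
Qed.

Lemma dist_rho_gt x y r : r < dist_rho x y -> exists k, r < dist_term x y k.
Proof.
move=> /sup_gt[|_ [k _ <-] ?]; last by exists k.
by exists (dist_term x y 0); exists 0%N.
Qed.

Lemma dist_rho_tail x y (K : nat) c : (forall k, (k < K)%N -> dist_term x y k <= c) ->
  2 ^- K <= c -> dist_rho x y <= c.
Proof.
move=> small tail; apply: dist_rho_le => k; have [/small //|le_Kk] := ltnP k K.
by rewrite (le_trans (dist_term_le _ _ _)) // (le_trans _ tail) // exp2_le.
Qed.

Lemma dist_rhoC x y : dist_rho x y = dist_rho y x.
Proof.
congr sup; congr image; apply/funext => k.
by rewrite /dist_term distrC.
Qed.

Lemma dist_rho_triangle x y z : dist_rho x z <= dist_rho x y + dist_rho y z.
Proof.
apply: dist_rho_le => k.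
apply: le_trans (lerD (le_dist_rho x y k) (le_dist_rho y z k)).
rewrite -mulrDr ler_wpM2l ?(ltW (exp2_gt0 k)) //.
have := ler_distD (coord k y) (coord k x) (coord k z).
have := normr_ge0 (coord k x - coord k y); have := normr_ge0 (coord k y - coord k z).
rewrite /Num.min; case: ifP; case: ifP; case: ifP; lra.
Qed.

Lemma coord_dist x y k m :
  dist_rho x y < 2 ^- (k + m) -> `|coord k x - coord k y| < 2 ^- m.
Proof.
move=> /(le_lt_trans (le_dist_rho x y k)).
rewrite exprD invfM /dist_term ltr_pM2l ?exp2_gt0 // gt_min; case/orP => //.
by rewrite ltNge invf_le1 ?exprn_gt0 // exprn_ege1 // ler1n.
Qed.

(** An explicit modulus of uniform continuity for [rho_m]: its real and imaginary parts are the
    coordinates [m.*2] and [m.*2.+1], and each contributes half of the error. *)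
Lemma rho_dist x y m t :
  dist_rho x y < 2 ^- (m.*2.+1 + t.+1) -> nrm (rho m x - rho m y) < 2 ^- t.
Proof.
move=> dxy; apply: le_lt_trans (nrm_ReIm _) _.
have -> : 2 ^- t = 2 ^- t.+1 + 2 ^- t.+1 :> R by rewrite exp2S -splitr.
have dRe := @coord_dist x y m.*2 t.+1; have dIm := @coord_dist x y m.*2.+1 t.+1.
rewrite /coord /= odd_double /= doubleK -raddfB in dRe.
rewrite /coord /= odd_double /= uphalf_double -raddfB in dIm.
rewrite ltrD ?dIm ?dRe //; apply: lt_le_trans dxy _.
by rewrite exp2_le // leq_add2r.
Qed.

Hypothesis X_nonempty : [set: X] !=set0.
Hypothesis X_compact : compact [set: X].
Hypothesis u_pres : is_algebra_presentation u.
Variable dist : X -> X -> R.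
Hypothesis dist_compat : compatible_metric dist.

(** A rational vector within [1 / 4] of a tent of height 1 at [x] has real part above [3 / 4] at
    [x]. Where the real part differs from this by less than [1 / 2] it exceeds [1 / 4], so the tent
    is positive there. *)
Lemma coord_separates (x : X) (U : set X) : nbhs x U ->
  exists k, [set y | `|coord k x - coord k y| < 1 / 2] `<=` U.
Proof.
have [_ _ _ dN] := dist_compat; move=> /dN[e e0 eU].
have cF : ctsC (fun y => (tent dist x e y / e)%:C%C).
  apply: ctsC_real => y; apply: (@cvgM R); last exact: cvg_cst.
  exact: tent_continuous.
have q0 : 0 < 4^-1 :> R by rewrite invr_gt0.
have [k kF] := dense_rho X_compact u_pres cF q0.
exists k.*2 => y /=; rewrite /coord odd_double doubleK => xy.
apply: eU => /=; rewrite -(tent_gt0 dist).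
have Fx := le_lt_trans (nrm_Re _) (kF x); have Fy := le_lt_trans (nrm_Re _) (kF y).
rewrite !raddfB /= in Fx Fy.
rewrite (tent_center dist_compat) ?(ltW e0) // divff ?gt_eqF // in Fx.
have : 0 < tent dist x e y / e.
  move: xy Fx Fy; rewrite !ltr_norml => /andP[h1 h2] /andP[h3 h4] /andP[h5 h6]; lra.
by rewrite pmulr_lgt0 // invr_gt0.
Qed.

Lemma coord_continuous k : continuous (coord k).
Proof.
move=> x; apply/cvgrPdist_lt => e e0.
have := @continuous_rho _ _ u k./2 x e e0.
apply: filterS => y xy; apply: le_lt_trans xy; rewrite /coord.
by case: odd; rewrite -raddfB ?nrm_Re ?nrm_Im.
Qed.

Lemma dist_rho_compatible : compatible_metric dist_rho.
Proof.
have nbhs_dist (x : X) (U : set X) :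
    nbhs x U <-> exists2 e, 0 < e & [set y | dist_rho x y < e] `<=` U.
  split=> [/coord_separates[k kU]|[e e0 eU]].
    exists (2 ^- (k + 1)); first exact: exp2_gt0.
    by move=> y /coord_dist xy; apply: kU; rewrite /= div1r.
  (* Coordinates from [K] on contribute less than [e / 2]; the first [K] are controlled by
     continuity. *)
  have [K Ke] : exists K, 2 ^- K < e / 2 by apply: exp2_small; rewrite divr_gt0.
  have : nbhs x [set y | forall k, (k < K)%N -> `|coord k x - coord k y| < e / 2].
    elim: (K) => [|n IH]; first by apply: filterS filterT.
    have /cvgrPdist_lt/(_ (e / 2)) := @coord_continuous n x.
    rewrite divr_gt0 // => /(_ isT) nn.
    near=> y => k; rewrite ltnS leq_eqVlt => /predU1P[->|lt_kn].
      by near: y.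
    by move: k lt_kn; near: y.
  apply: filterS => y small; apply: eU => /=.
  apply: le_lt_trans (_ : e / 2 < _); last by lra.
  apply: (@dist_rho_tail _ _ K); last exact: ltW.
  move=> k /small lt_k; rewrite (le_trans (dist_term_coord _ _ _)) //.
  apply: le_trans (_ : `|coord k x - coord k y| <= _); last exact: ltW.
  by rewrite ler_piMl // invf_le1 ?exprn_gt0 // exprn_ege1 // ler1n.
split; [|exact: dist_rhoC|exact: dist_rho_triangle|exact: nbhs_dist].
move=> x y; split => [xy0|->]; last first.
  apply/eqP; rewrite eq_le; apply/andP; split.
    apply: dist_rho_le => k; rewrite (le_trans (dist_term_coord _ _ _)) //.
    by rewrite subrr normr0 mulr0.
  exact: le_trans (dist_term_ge0 y y 0) (le_dist_rho _ _ _).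
(* Points at [dist_rho] distance 0 have the same neighbourhoods; were [dist x y] positive, the ball
   of that radius around [x] would be a neighbourhood of [x] without [y]. *)
have [d0 _ _ dN] := dist_compat; apply/(d0 x y); apply/eqP; apply: contrapT => dxy.
have dxy0 : 0 < dist x y by rewrite lt_def (dist_ge0 dist_compat) andbT; apply/negP.
have /nbhs_dist[e e0 eU] : nbhs x [set z | dist x z < dist x y].
  by apply/dN; exists (dist x y).
by have := eU y; rewrite /= xy0 ltxx => /(_ e0).
Unshelve. all: by end_near.
Qed.

(** * Semidecidable comparison of distances with rationals *)

Lemma finite_max (t : nat -> R) (r : R) n : (forall k, (k < n)%N -> t k < r) ->
  exists2 c, c < r & forall k, (k < n)%N -> t k <= c.
Proof.
elim: n => [|n IH] tr; first by exists (r - 1) => //; rewrite ltrBlDr ltrDl.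
have [|c cr tc] := IH; first by move=> k kn; apply: tr; rewrite ltnS ltnW.
exists (Num.max c (t n)); first by rewrite gt_max cr tr.
move=> k; rewrite ltnS leq_eqVlt le_max => /predU1P[->|/tc ->//].
by rewrite lexx orbT.
Qed.

(** The number [s] is both the precision of the approximations and the number of coordinates
    inspected; [2 * 2 ^- s] absorbs the errors of [A] and [B], and [2 ^- s < r] takes care of the
    tail. The minimum with 1 becomes a disjunction and the absolute value a conjunction; in [gt_chk]
    it is the other way round. *)
Definition lt_chk (A B : nat -> nat -> rat) (s : nat) (r : rat) : bool :=
  (2 ^- s < r) && all (fun k => (2 ^- k < r) ||
    ((2 ^- k * (A k s - B k s + 2 * 2 ^- s) < r) &&
     (2 ^- k * (B k s - A k s + 2 * 2 ^- s) < r))) (iota 0 s).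

Definition gt_chk (A B : nat -> nat -> rat) (s : nat) (r : rat) : bool :=
  has (fun k => (r < 2 ^- k) &&
    ((r < 2 ^- k * (A k s - B k s - 2 * 2 ^- s)) ||
     (r < 2 ^- k * (B k s - A k s - 2 * 2 ^- s)))) (iota 0 s).

Definition approximates (A : nat -> nat -> rat) (x : X) : Prop :=
  forall k s, `|coord k x - toR (A k s)| < 2 ^- s.

Lemma ratr_exp2 k : toR (2 ^- k) = 2 ^- k.
Proof. by rewrite fmorphV /= rmorphXn /= ratr_nat. Qed.

Section Approximations.
Variables (A B : nat -> nat -> rat) (x y : X).
Hypotheses (Ax : approximates A x) (By : approximates B y).

Lemma approx_diff k s :
  `|(coord k x - coord k y) - toR (A k s - B k s)| < 2 * 2 ^- s.
Proof.
rewrite rmorphB /=; have := Ax k s; have := By k s.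
by rewrite !ltr_norml => /andP[h1 h2] /andP[h3 h4]; apply/andP; split; lra.
Qed.

Lemma lt_chk_sound s r : lt_chk A B s r -> dist_rho x y < toR r.
Proof.
move=> /andP[]; rewrite -(@ltr_rat R) ratr_exp2 => sr /allP small.
have max_lt k : (k < s)%N -> dist_term x y k < toR r.
  move=> ks; have := small k; rewrite mem_iota add0n => /(_ ks) /orP[].
    by rewrite -(@ltr_rat R) ratr_exp2; apply/le_lt_trans/dist_term_le.
  rewrite -!(@ltr_rat R) !rmorphM !rmorphD !rmorphM !rmorphN /= !ratr_exp2 ratr_nat.
  move=> /andP[h1 h2]; apply: le_lt_trans (dist_term_coord _ _ _) _.
  have e0 := exp2_gt0 k.
  have := approx_diff k s; rewrite rmorphB /= ltr_norml => /andP[h3 h4].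
  rewrite mulrC -ltr_pdivlMr // in h1; rewrite mulrC -ltr_pdivlMr // in h2.
  rewrite mulrC -ltr_pdivlMr // ltr_norml; apply/andP; split; lra.
(* Bounding every term strictly would not bound the supremum strictly; the maximum of the first [s]
   terms and of the tail bound [2 ^- s] does. *)
have [c cr tc] := finite_max max_lt.
apply: (@le_lt_trans _ _ (Num.max c (2 ^- s))); last by rewrite gt_max cr.
apply: (@dist_rho_tail _ _ s) => [k /tc tck|]; rewrite le_max ?tck //.
by rewrite lexx orbT.
Qed.

Lemma lt_chk_complete r : dist_rho x y < toR r -> exists s, lt_chk A B s r.
Proof.
rewrite -subr_gt0 => lt_r.
(* The tested quantity exceeds the true one by less than [4 * 2 ^- s]: half is approximation error,
   half is the safety margin. *)
have [s sr] : exists s, 2 ^- s < (toR r - dist_rho x y) / 4.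
  by apply: exp2_small; rewrite divr_gt0.
have d0 : 0 <= dist_rho x y by exact: le_trans (dist_term_ge0 x y 0) (le_dist_rho _ _ _).
have s0 := exp2_gt0 s.
exists s; apply/andP; split; first by rewrite -(@ltr_rat R) ratr_exp2; lra.
apply/allP => k _; rewrite -!(@ltr_rat R) !rmorphM !rmorphD !rmorphM !rmorphN /=.
rewrite !ratr_exp2 ratr_nat; have [//|le_rk /=] := ltP.
have k0 := exp2_gt0 k; have k1 : 2 ^- k <= 1 :> R.
  by rewrite invf_le1 ?exprn_gt0 // exprn_ege1 // ler1n.
have := le_dist_rho x y k; rewrite /dist_term /Num.min; case: ifP => [_|_ dk].
  by rewrite mulr1; lra.
have := approx_diff k s; rewrite rmorphB /= ltr_norml => /andP[h1 h2].
have h3 := ler_norm (coord k x - coord k y).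
have h4 := ler_norm (coord k y - coord k x); rewrite distrC in h4.
have ks : 2 ^- k * (4 * 2 ^- s) <= 4 * 2 ^- s :> R by rewrite ler_piMl //; lra.
have bound z : z < `|coord k x - coord k y| + 4 * 2 ^- s -> 2 ^- k * z < toR r.
  rewrite -(ltr_pM2l k0 z) mulrDr => zk; lra.
by apply/andP; split; apply: bound; lra.
Qed.

Lemma gt_chk_sound s r : gt_chk A B s r -> toR r < dist_rho x y.
Proof.
move=> /hasP[k _]; rewrite -!(@ltr_rat R) !rmorphM !rmorphB !rmorphM /=.
rewrite !ratr_exp2 ratr_nat => /andP[rk h]; apply: lt_le_trans (le_dist_rho x y k).
have k0 := exp2_gt0 k.
have := approx_diff k s; rewrite rmorphB /= ltr_norml => /andP[h1 h2].
have h3 := ler_norm (coord k x - coord k y).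
have h4 := ler_norm (coord k y - coord k x); rewrite distrC in h4.
have bound z : z <= `|coord k x - coord k y| -> toR r < 2 ^- k * z ->
    toR r < dist_term x y k.
  move=> zk rz; rewrite /dist_term /Num.min; case: ifP => _; first by rewrite mulr1.
  by apply: lt_le_trans rz _; rewrite ler_wpM2l // ltW.
by case/orP: h; apply: bound; lra.
Qed.

Lemma gt_chk_complete r : toR r < dist_rho x y -> exists s, gt_chk A B s r.
Proof.
move=> /dist_rho_gt[k rk].
have k0 := exp2_gt0 k.
have rk1 : toR r < 2 ^- k := lt_le_trans rk (dist_term_le _ _ _).
have := le_trans (lexx _) (dist_term_coord x y k).
move=> /(lt_le_trans rk); rewrite -subr_gt0 => gap.
have [s0 s0r] : exists s, 2 ^- s < (2 ^- k * `|coord k x - coord k y| - toR r) / 4.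
  by apply: exp2_small; rewrite divr_gt0.
(* Taking at least [k.+1] brings the coordinate [k] into the inspected range. *)
pose s := (maxn s0 k.+1).
have sr : 2 ^- s <= 2 ^- s0 :> R by rewrite exp2_le // leq_maxl.
exists s; apply/hasP; exists k.
  by rewrite mem_iota add0n /s leq_maxr.
rewrite -!(@ltr_rat R) !rmorphM !rmorphB !rmorphM /= !ratr_exp2 ratr_nat rk1 /=.
have k1 : 2 ^- k <= 1 :> R.
  by rewrite invf_le1 ?exprn_gt0 // exprn_ege1 // ler1n.
have e0 := exp2_gt0 s.
have := approx_diff k s; rewrite rmorphB /= ltr_norml => /andP[h1 h2].
have ks : 2 ^- k * (4 * 2 ^- s) <= 4 * 2 ^- s :> R by rewrite ler_piMl //; lra.
have bound z : `|coord k x - coord k y| - 4 * 2 ^- s < z -> toR r < 2 ^- k * z.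
  rewrite -(ltr_pM2l k0 _ z) mulrBr => zk; lra.
have [xy|xy] := ltP 0 (coord k x - coord k y).
  by apply/orP; left; apply: bound; rewrite (gtr0_norm xy); lra.
by apply/orP; right; apply: bound; rewrite (ler0_norm xy); lra.
Qed.

End Approximations.
End Metric.

(** * Computability of the certificates *)

Definition evens (O : nat -> nat) n := O n.*2.
Definition odds (O : nat -> nat) n := O n.*2.+1.

Lemma evens_join f g : evens (join f g) = f.
Proof. by apply/funext => n; rewrite /evens /join odd_double doubleK. Qed.

Lemma odds_join f g : odds (join f g) = g.
Proof. by apply/funext => n; rewrite /odds /join /= odd_double /= uphalf_double. Qed.

(** For [r >= 0] this is [r <= |q|], squared so as to be decidable on rationals. *)
Definition q_large (q : nat) (r : rat) : bool :=
  r ^+ 2 <= rat_of_nat (p1 q) ^+ 2 + rat_of_nat (p2 q) ^+ 2.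

(* [w = <i', <q, <q', <t, W>>>>]: the set of [i'] lies inside that of [i], as
   [rho_(st_a f i)] is within [2^-t] of [q'] on it, and there [rho_k] is within
   [2^-s] of [q]. *)
Definition step_chk (f : nat -> nat) (i k s w : nat) : bool :=
  let W := p2 (p2 (p2 (p2 w))) in let t := p1 (p2 (p2 (p2 w))) in
  let q' := p1 (p2 (p2 w)) in
  [&& near f W (p1 w) k (p1 (p2 w)) (2 ^- s),
      near f W (p1 w) (st_a f i) q' (2 ^- t)
    & q_large q' (st_r f i + 2 ^- t)].

(** Here [w = <list of states, W>], and [e 3] is a vector within [1 / 8] of the unit. On one state
    each [rho_k] with [k <= j] varies by less than [2 * 2 ^- j.+2]; this controls the coordinates up
    to [j], and the later ones weigh at most [2 ^- j.+1], so distances within a state are below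
    [2 ^- j]. *)
Definition cover_chk (f e : nat -> nat) (j w : nat) : bool :=
  let l := CodeSeq.decode (p1 w) in let W := p2 w in
  [&& upper f W (cover_code f (e 3%N) (p1 w)) (1 / 4),
      all (fun i => st_r f i * (size l).*2%:R <= 1) l
    & all (fun i => all (fun k => has (fun q => near f W i k q (2 ^- j.+2))
        (iota 0 W)) (iota 0 j.+1)) l].

Section CmpChecks.
Variable P : (nat -> nat) -> Prop.
Local Notation fn := ((nat -> nat) -> nat -> nat).
Implicit Types a b c : fn.
Implicit Types d F G : (nat -> nat) -> nat -> rat.

Lemma cmp_evens a : cmp P a -> cmp P (fun O x => evens O (a O x)).
Proof. by move=> ca; rewrite /evens; cmp_auto. Qed.

Lemma cmp_odds a : cmp P a -> cmp P (fun O x => odds O (a O x)).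
Proof. by move=> ca; rewrite /odds; cmp_auto. Qed.
Hint Resolve cmp_evens cmp_odds : cmp.

Lemma cmp_st_a a : cmp P a -> cmp P (fun O x => st_a (evens O) (a O x)).
Proof. by move=> ca; rewrite /st_a; cmp_auto. Qed.

Lemma cmpQ_st_r a : cmp P a -> cmpQ P (fun O x => st_r (evens O) (a O x)).
Proof. by move=> ca; rewrite /st_r; cmp_auto. Qed.

Lemma cmpQ_st_R a : cmp P a -> cmpQ P (fun O x => st_R (evens O) (a O x)).
Proof. by move=> ca; rewrite /st_R; cmp_auto. Qed.

Lemma cmp_sub_code a b : cmp P a -> cmp P b ->
  cmp P (fun O x => sub_code (a O x) (b O x)).
Proof. by move=> *; rewrite /sub_code; cmp_auto. Qed.

Lemma cmp_mulsub_code a b c : cmp P a -> cmp P b -> cmp P c ->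
  cmp P (fun O x => mulsub_code (a O x) (b O x) (c O x)).
Proof. by move=> *; rewrite /mulsub_code; cmp_auto. Qed.
Hint Resolve cmp_st_a cmpQ_st_r cmpQ_st_R cmp_sub_code cmp_mulsub_code : cmp.

Lemma cmp_cover_code a b : cmp P a -> cmp P b ->
  cmp P (fun O x => cover_code (evens O) (a O x) (b O x)).
Proof.
move=> *; rewrite /cover_code.
by apply: (@cmp_fold _ (fun O x acc i =>
  scale_add (qrat 1) (st_a (evens O) i) acc)); cmp_auto.
Qed.

Lemma cmp_upper (W m : fn) d : cmp P W -> cmp P m -> cmpQ P d ->
  cmp P (fun O x => upper (evens O) (W O x) (m O x) (d O x)).
Proof.
move=> cW cm [c cc cd].
apply: (@cmp_ext _ (fun O x =>
    upper (evens O) (W O x) (m O x) (rat_of_nat (c O x)))).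
  by move=> O x PO; rewrite cd.
apply: (@cmp_comp3 _ (fun O W m r => upper (evens O) W m (rat_of_nat r))) => //.
rewrite /upper.
apply: (@cmp_has_iota _ (fun O z i => has (fun j => (st_a (evens O) j ==
  sub_code (p1 (p2 z)) (st_a (evens O) i)) && (st_R (evens O) i + st_R (evens O) j
    <= rat_of_nat (p2 (p2 z)))) (iota 0 (p1 z)))); cmp_auto.
apply: (@cmp_has_iota _ (fun O y j => (st_a (evens O) j ==
  sub_code (p1 (p2 (p1 y))) (st_a (evens O) (p2 y))) &&
  (st_R (evens O) (p2 y) + st_R (evens O) j
    <= rat_of_nat (p2 (p2 (p1 y)))))); cmp_auto.
Qed.
Hint Resolve cmp_cover_code cmp_upper : cmp.

Lemma cmp_near (W i k q : fn) d :
  cmp P W -> cmp P i -> cmp P k -> cmp P q -> cmpQ P d ->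
  cmp P (fun O x => near (evens O) (W O x) (i O x) (k O x) (q O x) (d O x)).
Proof.
move=> cW ci ck cq [c cc cd].
apply: (@cmp_ext _ (fun O x => (fun z => near (evens O) (p1 z) (p1 (p2 z))
  (p1 (p2 (p2 z))) (p1 (p2 (p2 (p2 z)))) (rat_of_nat (p2 (p2 (p2 (p2 z))))) : nat)
  (pr (W O x) (pr (i O x) (pr (k O x) (pr (q O x) (c O x))))))).
  by move=> O x PO; rewrite !prE cd.
apply: (@cmp_comp _ (fun O z => near (evens O) (p1 z) (p1 (p2 z))
  (p1 (p2 (p2 z))) (p1 (p2 (p2 (p2 z)))) (rat_of_nat (p2 (p2 (p2 (p2 z))))) : nat)); cmp_auto.
rewrite /near; apply: (@cmp_has_iota _ (fun O z v =>
  upper (evens O) (p1 z) (mulsub_code (st_a (evens O) (p1 (p2 z))) v (qrat 1))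
    (st_r (evens O) (p1 (p2 z)) / 4)
  && upper (evens O) (p1 z) (mulsub_code v (p1 (p2 (p2 z))) (p1 (p2 (p2 (p2 z)))))
    (3 / 4 * rat_of_nat (p2 (p2 (p2 (p2 z)))))) (fun O z => p1 z)); cmp_auto.
Qed.
Hint Resolve cmp_near : cmp.

Lemma cmp_q_large a d : cmp P a -> cmpQ P d ->
  cmp P (fun O x => q_large (a O x) (d O x)).
Proof.
move=> ca cd; rewrite /q_large.
by under eq_fun do under eq_fun do rewrite !expr2; cmp_auto.
Qed.
Hint Resolve cmp_q_large : cmp.

Lemma cmp_step_chk a b c (m : fn) : cmp P a -> cmp P b -> cmp P c -> cmp P m ->
  cmp P (fun O x => step_chk (evens O) (a O x) (b O x) (c O x) (m O x)).
Proof. by move=> *; rewrite /step_chk; cmp_auto. Qed.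

Lemma cmp_cover_chk a b : cmp P a -> cmp P b ->
  cmp P (fun O x => cover_chk (evens O) (odds O) (a O x) (b O x)).
Proof.
apply: (@cmp_comp2 _ (fun O j w => cover_chk (evens O) (odds O) j w : nat)).
rewrite /cover_chk; apply: cmp_andb; cmp_auto; apply: cmp_andb.
  apply: (@cmp_all_code _ (fun O z i =>
    st_r (evens O) i * (size (CodeSeq.decode (p1 (p2 z)))).*2%:R <= 1)
    (fun O z => p1 (p2 z))); cmp_auto.
apply: (@cmp_all_code _ (fun O z i => all (fun k => has (fun q =>
   near (evens O) (p2 (p2 z)) i k q (2 ^- (p1 z).+2)) (iota 0 (p2 (p2 z))))
   (iota 0 (p1 z).+1)) (fun O z => p1 (p2 z))); cmp_auto.
apply: (@cmp_all_iota _ (fun O y k => has (fun q =>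
   near (evens O) (p2 (p2 (p1 y))) (p2 y) k q (2 ^- (p1 (p1 y)).+2))
   (iota 0 (p2 (p2 (p1 y))))) (fun O y => (p1 (p1 y)).+1)); cmp_auto.
apply: (@cmp_has_iota _ (fun O t q =>
   near (evens O) (p2 (p2 (p1 (p1 t)))) (p2 (p1 t)) (p2 t) q
     (2 ^- (p1 (p1 (p1 t))).+2))
   (fun O t => p2 (p2 (p1 (p1 t))))); cmp_auto.
Qed.

Definition cmpA (A : (nat -> nat) -> nat -> nat -> nat -> rat) : Prop :=
  cmpQ P (fun O z => A O (p1 z) (p1 (p2 z)) (p2 (p2 z))).

Lemma cmpQ_comp F a : cmpQ P F -> cmp P a -> cmpQ P (fun O x => F O (a O x)).
Proof.
move=> [c cc cF] ca; exists (fun O x => c O (a O x)); first exact: cmp_comp.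
by move=> O x PO; exact: cF.
Qed.

Lemma cmpQ_app A a b c : cmpA A -> cmp P a -> cmp P b -> cmp P c ->
  cmpQ P (fun O x => A O (a O x) (b O x) (c O x)).
Proof.
move=> cA ca cb cc.
have [g cg gA] := cmpQ_comp cA (cmp_pr ca (cmp_pr cb cc)).
by exists g => // O x PO; rewrite gA // !prE.
Qed.

Lemma cmp_lt_chk A B a b (s : fn) d : cmpA A -> cmpA B ->
  cmp P a -> cmp P b -> cmp P s -> cmpQ P d ->
  cmp P (fun O x => lt_chk (A O (a O x)) (B O (b O x)) (s O x) (d O x)).
Proof.
move=> cA cB ca cb cs [c cc cd].
apply: (@cmp_ext _ (fun O x => (fun z => lt_chk (A O (p1 z)) (B O (p1 (p2 z)))
  (p1 (p2 (p2 z))) (rat_of_nat (p2 (p2 (p2 z)))) : nat)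
  (pr (a O x) (pr (b O x) (pr (s O x) (c O x)))))).
  by move=> O x PO; rewrite !prE cd.
apply: (@cmp_comp _ (fun O z => lt_chk (A O (p1 z)) (B O (p1 (p2 z)))
  (p1 (p2 (p2 z))) (rat_of_nat (p2 (p2 (p2 z)))) : nat)); cmp_auto.
rewrite /lt_chk; apply: cmp_andb; cmp_auto.
have cA' := cmpQ_app cA; have cB' := cmpQ_app cB.
apply: (@cmp_all_iota _ (fun O z k =>
    let s := p1 (p2 (p2 z)) in let r := rat_of_nat (p2 (p2 (p2 z))) in
    let x := A O (p1 z) k s in let y := B O (p1 (p2 z)) k s in
    (2 ^- k < r) || ((2 ^- k * (x - y + 2 * 2 ^- s) < r) &&
      (2 ^- k * (y - x + 2 * 2 ^- s) < r)))
  (fun O z => p1 (p2 (p2 z)))); cmp_auto.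
Qed.

Lemma cmp_gt_chk A B a b (s : fn) d : cmpA A -> cmpA B ->
  cmp P a -> cmp P b -> cmp P s -> cmpQ P d ->
  cmp P (fun O x => gt_chk (A O (a O x)) (B O (b O x)) (s O x) (d O x)).
Proof.
move=> cA cB ca cb cs [c cc cd].
apply: (@cmp_ext _ (fun O x => (fun z => gt_chk (A O (p1 z)) (B O (p1 (p2 z)))
  (p1 (p2 (p2 z))) (rat_of_nat (p2 (p2 (p2 z)))) : nat)
  (pr (a O x) (pr (b O x) (pr (s O x) (c O x)))))).
  by move=> O x PO; rewrite !prE cd.
apply: (@cmp_comp _ (fun O z => gt_chk (A O (p1 z)) (B O (p1 (p2 z)))
  (p1 (p2 (p2 z))) (rat_of_nat (p2 (p2 (p2 z)))) : nat)); cmp_auto.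
have cA' := cmpQ_app cA; have cB' := cmpQ_app cB.
rewrite /gt_chk; apply: (@cmp_has_iota _ (fun O z k =>
    let s := p1 (p2 (p2 z)) in let r := rat_of_nat (p2 (p2 (p2 z))) in
    let x := A O (p1 z) k s in let y := B O (p1 (p2 z)) k s in
    (r < 2 ^- k) && ((r < 2 ^- k * (x - y - 2 * 2 ^- s)) ||
      (r < 2 ^- k * (y - x - 2 * 2 ^- s))))
  (fun O z => p1 (p2 (p2 z)))); cmp_auto.
Qed.

End CmpChecks.
#[global] Hint Resolve cmp_evens cmp_odds cmp_st_a cmpQ_st_r cmp_step_chk cmp_cover_chk
   cmp_lt_chk cmp_gt_chk : cmp.

(** * Points and covers *)

Lemma q_largeE (R : realType) q r : 0 <= r ->
  q_large q r = (ratr r <= nrm (@qval R q)).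
Proof.
move=> r0; rewrite /q_large qvalE /= -(@ler_rat R) !rmorphD !rmorphXn /=.
set N := _ + _; have N0 : 0 <= N by rewrite addr_ge0 ?sqr_ge0.
by rewrite -{1}(sqr_sqrtr N0) ler_sqr ?nnegrE ?sqrtr_ge0 // ler0q.
Qed.

Lemma ratrD_exp2 (R : realType) (r : rat) t :
  ratr (r + 2 ^- t) = ratr r + 2 ^- t :> R.
Proof. by rewrite rmorphD /= ratr_exp2. Qed.

Lemma uniform_bound (T : eqType) (l : seq T) (Q : T -> nat -> Prop) :
  (forall i W W', (W <= W')%N -> Q i W -> Q i W') ->
  (forall i, i \in l -> exists W, Q i W) ->
  exists W, forall i, i \in l -> Q i W.
Proof.
move=> mono; elim: l => [|i l IH] ex; first by exists 0%N.
have [|W0 W0P] := IH; first by move=> j jl; apply: ex; rewrite inE jl orbT.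
have [W1 W1P] := ex i (mem_head i l).
exists (maxn W0 W1) => j; rewrite inE => /predU1P[->|/W0P].
  by apply: mono W1P; rewrite leq_maxr.
by apply: mono; rewrite leq_maxl.
Qed.

Section Points.
Context {R : realType} (X : topologicalType).
Hypothesis X_nonempty : [set: X] !=set0.
Hypothesis X_compact : compact [set: X].
Variable dist : X -> X -> R.
Hypothesis dist_compat : compatible_metric dist.
Variable u : nat -> continuousType X (R[i]^o).
Hypothesis u_pres : is_algebra_presentation u.
Variable f : nat -> nat.
Hypothesis f_name : algebra_name u f.

Local Notation rho := (rho u).
Local Notation qval := (@qval R).
Local Notation toR := (@ratr R).
Local Notation V i := [set x | toR (st_r f i) <= nrm (rho (st_a f i) x)].

Lemma nbhs_rho (x : X) k (z : R[i]) e : nrm (rho k x - z) < e ->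
  nbhs x [set y | nrm (rho k y - z) < e].
Proof.
rewrite -subr_gt0 => gap; have := @continuous_rho _ _ u k x _ gap.
apply: filterS => y /= xy; rewrite nrmB in xy.
by have := nrm_triangleB (rho k y) (rho k x) z; lra.
Qed.

(** Take a point where [|rho_a|] exceeds the threshold, complex rationals [q'] and [q] near the
    values of [rho_a] and [rho_k] there, and a state so small that both values stay close on its
    enlarged set; then [near_complete] applies twice. *)
Lemma step_complete i k s : exists w, step_chk f i k s w.
Proof.
have [x0] := state_point X_nonempty f_name i.
rewrite -subr_gt0 => gap.
(* Since the gap exceeds [2 * 2 ^- t] and [q'] is within [2 ^- t / 2] of the value, [|q'|] is at
   least [r + 2 ^- t], as [q_large] demands. *)
have [t tgap] : exists t, 2 ^- t < (nrm (rho (st_a f i) x0) - toR (st_r f i)) / 2.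
  by apply: exp2_small; rewrite divr_gt0.
have t0 := @exp2_gt0 R t; have s0 := @exp2_gt0 R s.
have [q' q'x] : exists q', nrm (rho (st_a f i) x0 - qval q') < 2 ^- t / 2.
  by apply: qval_dense; rewrite divr_gt0.
have [q qx] : exists q, nrm (rho k x0 - qval q) < 2 ^- s / 2.
  by apply: qval_dense; rewrite divr_gt0.
have [i' i'P] := state_inside X_compact dist_compat u_pres f_name
  (filterI (nbhs_rho q'x) (nbhs_rho qx)).
have [W1 W1P] : exists W, near f W i' k q (2 ^- s).
  apply: (near_complete X_nonempty X_compact u_pres f_name).
    by rewrite invr_gt0 exprn_gt0.
  by move=> x /i'P[_ /ltW]; rewrite ratr_exp2.
have [W2 W2P] : exists W, near f W i' (st_a f i) q' (2 ^- t).
  apply: (near_complete X_nonempty X_compact u_pres f_name).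
    by rewrite invr_gt0 exprn_gt0.
  by move=> x /i'P[/ltW + _]; rewrite ratr_exp2.
have [ri _ _ _] := state_spec f_name i.
exists (pr i' (pr q (pr q' (pr t (maxn W1 W2))))); rewrite /step_chk !prE.
rewrite (near_mono (leq_maxl _ _) W1P) (near_mono (leq_maxr _ _) W2P) /=.
rewrite (q_largeE R) ?addr_ge0 ?(ltW ri) ?invr_ge0 ?exprn_ge0 //.
rewrite ratrD_exp2.
have := nrm_ler_dist (rho (st_a f i) x0) (qval q').
by rewrite ler_norml => /andP[_]; lra.
Qed.

Lemma step_sound i k s w x : step_chk f i k s w -> V (p1 w) x ->
  V i x /\ nrm (rho k x - qval (p1 (p2 w))) < 2 ^- s.
Proof.
case/and3P=> n1 n2; have [ri _ _ _] := state_spec f_name i.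
rewrite (q_largeE R) ?addr_ge0 ?(ltW ri) ?invr_ge0 ?exprn_ge0 // => large Vx.
have := near_sound X_compact f_name n1 Vx; rewrite ratr_exp2 => h1.
have := near_sound X_compact f_name n2 Vx; rewrite ratr_exp2 => h2.
split=> //; rewrite ratrD_exp2 in large; rewrite /mkset.
have := nrm_ler_dist (rho (st_a f i) x) (qval (p1 (p2 (p2 w)))).
by rewrite ler_norml => /andP[h3 _]; lra.
Qed.

(** By compactness a sequence of points chosen in the successive sets has a cluster point. It lies
    in each set, since the sets decrease and have open complements. *)
Lemma nested_states (st : nat -> nat) :
  (forall t, V (st t.+1) `<=` V (st t)) -> exists x, forall t, V (st t) x.
Proof.
move=> decr.
have /choice[y yP] t : exists x, V (st t) x.
  by have [x /ltW] := state_point X_nonempty f_name (st t); exists x.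
have mono t n : V (st (t + n)%N) `<=` V (st t).
  elim: n => [|n IH]; first by rewrite addn0.
  by rewrite addnS; apply: subset_trans IH; exact: decr.
have [x [_ xcl]] := X_compact (F := y @ \oo) _ filterT.
exists x => t; apply: contrapT => /negP; rewrite /= -ltNge => lt_x.
have nx : nbhs x [set z | nrm (rho (st_a f (st t)) z) < toR (st_r f (st t))].
  have := @nbhs_rho x (st_a f (st t)) 0 (toR (st_r f (st t))).
  rewrite subr0 => /(_ lt_x); apply: filterS => z /=.
  by rewrite subr0.
have tail : (y @ \oo) (V (st t)).
  exists t => // n /= tn; have := yP n; rewrite -(subnKC tn); exact: mono.
have [z [/= h1 h2]] := xcl _ _ tail nx.
by move: h2; rewrite ltNge h1.
Qed.

Lemma unit_close e x : point_name (M := algebra_of u) (algebra_one R X) e ->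
  nrm (rho (e 3%N) x - 1) < 8^-1.
Proof.
move=> /(_ 3%N) h.
rewrite (_ : 8^-1 = 2 ^- 3 :> R); last by congr (_^-1); rewrite -natrX.
apply: le_lt_trans h.
apply: (@le_supnorm _ _ X_compact (fun x => rho (e 3%N) x - 1) x).
by apply: ctsCB; [exact: continuous_rho|exact: ctsC_cst].
Qed.

Lemma cover_chk_complete e j : point_name (M := algebra_of u) (algebra_one R X) e ->
  exists w, cover_chk f e j w.
Proof.
move=> e_name.
have e3 x := unit_close x e_name.
have j0 := @exp2_gt0 R j.+2.
have /choice[q qP] (y : X * nat) : exists q, nrm (rho y.2 y.1 - qval q) < 2 ^- j.+2 / 2.
  by apply: qval_dense; rewrite divr_gt0.
(* On [U x n] the first [n] rational vectors are within half the required precision of fixed complex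
   rationals, which is what [near_complete] needs. *)
pose U (x : X) n := [set y | forall k, (k < n)%N ->
  nrm (rho k y - qval (q (x, k))) < 2 ^- j.+2 / 2].
have nU x n : nbhs x (U x n).
  elim: n => [|n IH]; first by apply: filterS filterT.
  have qx : nrm (rho n x - qval (q (x, n))) < 2 ^- j.+2 / 2 := qP (x, n).
  apply: filterS (filterI (nbhs_rho qx) IH) => y [yn yk] k.
  by rewrite ltnS leq_eqVlt => /predU1P[->|kn]; [exact: yn|exact: yk].
have [s [[W0 W0P] sr sU]] := cover_complete X_nonempty X_compact dist_compat u_pres
  f_name (nU^~ j.+1) e3.
(* Certificates persist when [W] grows, so finitely many searches share one bound, which also bounds
   the codes [q]. *)
have [W WP] : exists W, forall i, i \in CodeSeq.decode s ->
    forall k, k \in iota 0 j.+1 ->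
    exists2 q, (q < W)%N & near f W i k q (2 ^- j.+2).
  apply: (uniform_bound (Q := fun i W => forall k, k \in iota 0 j.+1 ->
    exists2 q, (q < W)%N & near f W i k q (2 ^- j.+2))).
    move=> i W W' WW' QW k /QW[n nW nP]; exists n; first exact: leq_trans WW'.
    exact: near_mono WW' nP.
  move=> i /sU[x xU].
  apply: (uniform_bound (Q := fun k W =>
    exists2 q, (q < W)%N & near f W i k q (2 ^- j.+2))).
    move=> k W W' WW' [n nW nP]; exists n; first exact: leq_trans WW'.
    exact: near_mono WW' nP.
  move=> k; rewrite mem_iota add0n => /= kj.
  have [W WP] : exists W, near f W i k (q (x, k)) (2 ^- j.+2).
    apply: (near_complete X_nonempty X_compact u_pres f_name).
      by rewrite invr_gt0 exprn_gt0.
    by move=> y /xU/(_ k kj)/ltW; rewrite ratr_exp2.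
  exists (maxn W (q (x, k)).+1), (q (x, k)); first by rewrite leq_maxr.
  by apply: near_mono WP; rewrite leq_maxl.
exists (pr s (maxn W0 W)); rewrite /cover_chk !prE.
apply/and3P; split; [exact: upper_mono (leq_maxl _ _) W0P|exact: sr|].
apply/allP => i /WP{}WP; apply/allP => k /WP[n nW nP]; apply/hasP; exists n.
  by rewrite mem_iota add0n (leq_trans nW) ?leq_maxr.
by apply: near_mono nP; rewrite leq_maxr.
Qed.

Lemma cover_chk_sound e j w x : point_name (M := algebra_of u) (algebra_one R X) e ->
  cover_chk f e j w -> exists2 i, i \in CodeSeq.decode (p1 w) &
    V i x /\ forall y, V i y -> dist_rho u y x < 2 ^- j.
Proof.
move=> e_name.
have e3 := unit_close x e_name.
case/and3P => up sr /allP small.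
have [i il Vx] := cover_sound X_compact f_name up e3 sr.
exists i => //; split => // y Vy.
have j0 := @exp2_gt0 R j.
apply: le_lt_trans (_ : 2 ^- j.+1 < _); last by rewrite exp2S; lra.
apply: (@dist_rho_tail _ _ _ _ _ j.+1) => // k kj.
have /allP/(_ k./2) := small i il; rewrite mem_iota add0n.
have -> : (k./2 < j.+1)%N.
  by apply: leq_ltn_trans kj; rewrite -[leqRHS]odd_double_half; lia.
move=> /(_ isT)/hasP[q _ nq].
have := near_sound X_compact f_name nq Vx; rewrite ratr_exp2 => h1.
have := near_sound X_compact f_name nq Vy; rewrite ratr_exp2 => h2.
have h3 : nrm (rho k./2 y - rho k./2 x) <= 2 ^- j.+1.
  have := nrm_triangleB (rho k./2 y) (qval q) (rho k./2 x).
  by rewrite [nrm (qval q - _)]nrmB; have := @exp2S R j.+1; lra.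
apply: le_trans (dist_term_coord _ _ _ _) _.
apply: le_trans h3; apply: le_trans (_ : `|coord u k y - coord u k x| <= _).
  by rewrite ler_piMl // invf_le1 ?exprn_gt0 // exprn_ege1 // ler1n.
by rewrite /coord; case: odd; rewrite -raddfB ?nrm_Re ?nrm_Im.
Qed.

End Points.

(** * Computing the points from the names *)

(** The promise under which the searches succeed. As [u] is quantified inside it, one functional
    serves all presentations of the algebra. *)
Definition good (R : realType) (X : topologicalType) (O : nat -> nat) : Prop :=
  exists (u : nat -> continuousType X (R[i]^o)) f e,
    [/\ is_algebra_presentation u, input_names u f e & O = join f e].

Definition cval (val : (nat -> nat) -> nat -> nat -> nat -> nat)
    (O : nat -> nat) (n k s : nat) : rat :=
  rat_of_nat (if odd k then p2 (val O n k./2 s) else p1 (val O n k./2 s)).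

Definition cmp3 (P : (nat -> nat) -> Prop)
    (val : (nat -> nat) -> nat -> nat -> nat -> nat) : Prop :=
  cmp P (fun O z => val O (p1 z) (p1 (p2 z)) (p2 (p2 z))).

Lemma cmp3_app P val a b c : cmp3 P val -> cmp P a -> cmp P b -> cmp P c ->
  cmp P (fun O x => val O (a O x) (b O x) (c O x)).
Proof. exact: cmp_comp3. Qed.

Lemma cmpA_cval P val : cmp3 P val -> cmpA P (cval val).
Proof.
move=> cv; rewrite /cmpA /cval; apply: cmpQ_of.
by apply: cmp_if; cmp_auto; [apply: cmp_p2|apply: cmp_p1]; apply: cmp3_app; cmp_auto.
Qed.

Section Construction.
Context {R : realType} (X : topologicalType).
Hypothesis X_nonempty : [set: X] !=set0.
Hypothesis X_compact : compact [set: X].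
Variable dist : X -> X -> R.
Hypothesis dist_compat : compatible_metric dist.
Local Notation toR := (@ratr R).
Local Notation good := (good R X).
Implicit Type u : nat -> continuousType X (R[i]^o).

Lemma cval_approximates u val O n x :
  (forall k s, nrm (rho u k x - qval (val O n k s)) < 2 ^- s) ->
  approximates u (cval val O n) x.
Proof.
move=> vx k s; apply: le_lt_trans (vx k./2 s); rewrite /coord /cval qvalE.
by case: odd; [rewrite (le_trans _ (nrm_Im _)) //|rewrite (le_trans _ (nrm_Re _)) //];
  rewrite raddfB.
Qed.

Lemma points_exist : exists2 val : (nat -> nat) -> nat -> nat -> nat -> nat,
  cmp3 good val &
  forall u f e, is_algebra_presentation u -> input_names u f e -> forall n,
    exists x, toR (st_r f n) <= nrm (rho u (st_a f n) x) /\
      forall k s, nrm (rho u k x - qval (val (join f e) n k s)) < 2 ^- s.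
Proof.
have [|O x [u [f [e [u_pres [f_name _] ->]]]]|step cstep stepP] := @cmp_search good
  (fun O x w => step_chk (evens O) (p1 x) (p1 (p2 x)) (p2 (p2 x)) w).
- by cmp_auto.
- rewrite evens_join.
  exact: (step_complete X_nonempty X_compact dist_compat u_pres f_name).
(* The time [t] is read as a pair [<k, s>]: this step refines the state until [rho_k] is known to
   within [2 ^- s]. Pairing is a bijection, so every vector gets every precision. *)
pose traj O n t := nrec n (fun t i => p1 (step O (pr i t))) t.
have ctraj : cmp good (fun O z => traj O (p1 z) (p2 z)).
  apply: (@cmp_nrec _ (fun O z => p1 z) (fun O z t i => p1 (step O (pr i t)))); cmp_auto.
  by apply: cmp_p1; apply: (@cmp_comp _ step); cmp_auto.
exists (fun O n k s => p1 (p2 (step O (pr (traj O n (pr k s)) (pr k s))))).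
  rewrite /cmp3; apply: cmp_p1; apply: cmp_p2; apply: (@cmp_comp _ step) => //.
  apply: cmp_pr; cmp_auto.
  by apply: (@cmp_comp2 _ traj); cmp_auto.
move=> u f e u_pres fe n; have [f_name _] := fe.
have O_good : good (join f e) by exists u, f, e.
have stepS i t : step_chk f i (p1 t) (p2 t) (step (join f e) (pr i t)).
  by have := stepP _ (pr i t) O_good; rewrite evens_join !prE.
have [|x xP] := nested_states X_nonempty X_compact f_name (st := traj (join f e) n).
  by move=> t x /(step_sound X_compact f_name (stepS _ _))[].
exists x; split; first exact: (xP 0%N).
(* The limit point also lies in the state reached just after time [pr k s], where the complex
   rational found at that step is accurate. *)
move=> k s; have [_] := step_sound X_compact f_name (stepS _ _) (xP (pr k s).+1).
by rewrite !prE.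
Qed.

End Construction.

(** * The presentation *)

Lemma code4E r j k r' :
  code4 r j k r' = pr (code_rat r) (pr j (pr k (code_rat r'))).
Proof. by []. Qed.

(** Here [w] is [<<s1, s2>, n>]: a candidate entry [n] and the stages at which its two inequalities
    are tested. A name may list only codes of the form [code_rat r], whence the test [canonical]. *)
Definition diag_chk (val : (nat -> nat) -> nat -> nat -> nat -> nat)
    (O : nat -> nat) (w : nat) : bool :=
  let n := p2 w in let r := p1 n in let j := p1 (p2 n) in
  let k := p1 (p2 (p2 n)) in let r' := p2 (p2 (p2 n)) in
  [&& canonical r, canonical r',
      gt_chk (cval val O j) (cval val O k) (p1 (p1 w)) (rat_of_nat r)
    & lt_chk (cval val O j) (cval val O k) (p2 (p1 w)) (rat_of_nat r')].

(* The default entry belongs to every diagram, all distances being at most 1. *)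
Definition diagram val (O : nat -> nat) (w : nat) : nat :=
  if diag_chk val O w then p2 w else code4 (-1) 0 0 2.

Lemma cmp_diagram P val : cmp3 P val -> cmp P (diagram val).
Proof.
move=> cv; have cA := cmpA_cval cv.
apply: cmp_if; cmp_auto.
by rewrite /diag_chk; cmp_auto.
Qed.

Section Presentation.
Context {R : realType} (X : topologicalType).
Hypothesis X_nonempty : [set: X] !=set0.
Hypothesis X_compact : compact [set: X].
Variable dist : X -> X -> R.
Hypothesis dist_compat : compatible_metric dist.
Local Notation toR := (@ratr R).
Local Notation good := (good R X).
Variable val : (nat -> nat) -> nat -> nat -> nat -> nat.
Hypothesis val_cmp : cmp3 good val.
Variable u : nat -> continuousType X (R[i]^o).
Hypothesis u_pres : is_algebra_presentation u.

Definition locates (f e : nat -> nat) (pts : nat -> X) : Prop :=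
  forall n, toR (st_r f n) <= nrm (rho u (st_a f n) (pts n)) /\
    forall k s, nrm (rho u k (pts n) - qval (val (join f e) n k s)) < 2 ^- s.

Section OneName.
Variables f e : nat -> nat.
Hypothesis fe : input_names u f e.
Variable pts : nat -> X.
Hypothesis pts_loc : locates f e pts.
Local Notation M := (space_of (SpacePresentation (dist_rho u) pts)).

Lemma locates_approx n : approximates u (cval val (join f e) n) (pts n).
Proof. by have [_ /cval_approximates] := pts_loc n. Qed.

(** A state inside the ball contributes its own point: [pts i] satisfies the threshold of state [i],
    hence also an eighth of it. *)
Lemma points_dense x (r : R) : 0 < r -> exists n, dist_rho u (pts n) x < r.
Proof.
move=> r0; have [f_name _] := fe.
have [_ _ _ dN] := dist_rho_compatible X_compact u_pres dist_compat.
have nx : nbhs x [set y | dist_rho u x y < r] by apply/dN; exists r.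
have [i iU] := state_inside X_compact dist_compat u_pres f_name nx.
exists i; rewrite dist_rhoC; apply: iU; have [pi _] := pts_loc i.
apply: le_trans pi; have [ri _ _ _] := state_spec f_name i.
by rewrite ler_pdivrMr // ler_peMr ?ler1n // ler0q ltW.
Qed.

Lemma presentation_is : is_space_presentation (SpacePresentation (dist_rho u) pts).
Proof.
split; first exact: (dist_rho_compatible X_compact u_pres dist_compat).
by move=> x r; exact: points_dense.
Qed.

Lemma diagram_name : metric_name M (diagram val (join f e)).
Proof.
apply/seteqP; split => [_ [w _ <-]|_ [r [j [k [r' [rd dr' ->]]]]]].
  rewrite /diagram; case: ifP => [/and4P[c1 c2 g1 l1]|_].
    exists (rat_of_nat (p1 (p2 w))), (p1 (p2 (p2 w))), (p1 (p2 (p2 (p2 w)))),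
      (rat_of_nat (p2 (p2 (p2 (p2 w))))); split.
    - exact (gt_chk_sound (locates_approx _) (locates_approx _) g1).
    - exact (lt_chk_sound (locates_approx _) (locates_approx _) l1).
    - by rewrite code4E !canonicalP // !pr_p1p2.
  exists (-1), 0%N, 0%N, 2; split => //=.
    rewrite rmorphN rmorph1; apply: lt_le_trans (le_dist_rho u (pts 0%N) (pts 0%N) 0).
    by apply: lt_le_trans (dist_term_ge0 _ _ _ _); rewrite oppr_lt0.
  rewrite ratr_nat; apply: le_lt_trans (_ : 1 < _); last by rewrite ltr1n.
  apply: dist_rho_le => n; apply: le_trans (dist_term_le _ _ _ _) _.
  by rewrite invf_le1 ?exprn_gt0 // exprn_ege1 // ler1n.
have [s1 gs] := gt_chk_complete (locates_approx j) (locates_approx k) rd.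
have [s2 ls] := lt_chk_complete (locates_approx j) (locates_approx k) dr'.
exists (pr (pr s1 s2) (code4 r j k r')) => //.
by rewrite /diagram /diag_chk code4E !prE !canonical_code !code_ratK gs ls.
Qed.

Lemma evaluation : evaluative (join f e) u (SpacePresentation (dist_rho u) pts).
Proof.
pose Q (O : nat -> nat) := good (evens O).
(* Three errors of at most [2 ^- t.+2] are added: from [F] to [rho_m], from [rho_m] at [p] to
   [rho_m] at the named point, and from there to [val]. The second needs the point to precision
   [m.*2.+1 + t.+3], by [rho_dist]. *)
pose m O t := p1 (odds O t.+2).
pose out O t := val (evens O) (p2 (odds O ((m O t).*2.+1 + t.+3))) (m O t) t.+2.
have [c cP] : cmp Q out.
  have cm : cmp Q m by rewrite /m; cmp_auto.
  have cv : cmp3 Q (fun O => val (evens O)).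
    by apply: (@cmp_subst Q good evens) val_cmp => //; cmp_auto.
  by apply: (cmp3_app cv); cmp_auto.
exists c => -[F p] w w_name; exists (out (join (join f e) w)).
  by apply: cP; rewrite /Q evens_join; exists u, f, e.
move=> t; rewrite /out /m evens_join odds_join.
have cF : ctsC F by apply/ctsCP => x; exact: (@cts_fun _ _ F).
have w_split k : nrm (rho u (p1 (w k)) p - F p) < 2 ^- k /\
    dist_rho u (pts (p2 (w k))) p < 2 ^- k.
  have : Num.max (supnorm (fun x => rho u (p1 (w k)) x - F x))
    (dist_rho u (pts (p2 (w k))) p) < 2 ^- k := w_name k.
  rewrite gt_max => /andP[wF wp]; split => //; apply: le_lt_trans wF.
  apply: (@le_supnorm _ _ X_compact (fun x => rho u (p1 (w k)) x - F x) p).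
  by apply: ctsCB => //; exact: continuous_rho.
set n := p1 (w t.+2); set j := p2 (w _).
have [h1 _] := w_split t.+2; have [_ /rho_dist h2] := w_split (n.*2.+1 + t.+3)%N.
have [_ /(_ n t.+2) h3] := pts_loc j.
suff : nrm (qval (val (join f e) j n t.+2) - F p) < 2 ^- t by [].
have t1 := nrm_triangleB (qval (val (join f e) j n t.+2)) (rho u n p) (F p).
have t2 := nrm_triangleB (qval (val (join f e) j n t.+2)) (rho u n (pts j)) (rho u n p).
rewrite [nrm (_ - rho u n (pts j))]nrmB in t2.
have e1 := @exp2S R t; have e2 := @exp2S R t.+1; have e0 := @exp2_gt0 R t.
rewrite -/n -/j in h1 h2; lra.
Qed.

End OneName.

(** Both presentations carry the metric [dist_rho u], so a point of the second close to a given
    point of the first exists by density and is recognised by [lt_chk]. [G1] and [G2] extract the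
    two pairs of names from [D], which lets one statement serve both directions. *)
Lemma name_translation f1 e1 f2 e2 pts1 pts2 (D : nat -> nat)
    (G1 G2 : (nat -> nat) -> nat -> nat) :
  input_names u f1 e1 -> input_names u f2 e2 ->
  locates f1 e1 pts1 -> locates f2 e2 pts2 ->
  (forall P, cmp P G1) -> (forall P, cmp P G2) ->
  G1 D = join f1 e1 -> G2 D = join f2 e2 ->
  computable_map D (M := space_of (SpacePresentation (dist_rho u) pts1))
    (N := space_of (SpacePresentation (dist_rho u) pts2)) (fun x => x).
Proof.
move=> fe1 fe2 loc1 loc2 cG1 cG2 D1 D2.
pose Q (O : nat -> nat) := exists x w, point_name
  (M := space_of (SpacePresentation (dist_rho u) pts1)) x w /\ O = join D w.
have cv G : (forall P, cmp P G) -> good (G D) -> cmp3 Q (fun O => val (G (evens O))).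
  move=> cG gD; apply: (@cmp_subst Q good (fun O => G (evens O))) val_cmp.
    by apply: (@cmp_subst Q (fun=> True) evens); cmp_auto.
  by move=> _ [x [w [_ ->]]]; rewrite evens_join.
have cA1 : cmpA Q (fun O => cval val (G1 (evens O))).
  by apply: (@cmpA_cval Q (fun O => val (G1 (evens O)))); apply: cv => //;
    rewrite D1; exists u, f1, e1.
have cA2 : cmpA Q (fun O => cval val (G2 (evens O))).
  by apply: (@cmpA_cval Q (fun O => val (G2 (evens O)))); apply: cv => //;
    rewrite D2; exists u, f2, e2.
(* The witness [y] is [<n, s>], a point and a stage. The named point is within [2 ^- t.+1] of [x],
   and the point found is equally close to it, which adds up to [2 ^- t]. *)
have [||F cF FP] := @cmp_search Q (fun O t y =>
  lt_chk (cval val (G1 (evens O)) (odds O t.+1)) (cval val (G2 (evens O)) (p1 y))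
    (p2 y) (2 ^- t.+1)).
- apply: cmp_negb; apply: (@cmp_lt_chk Q (fun O => cval val (G1 (evens O)))
    (fun O => cval val (G2 (evens O)))); cmp_auto.
- move=> _ t [x [w [xw ->]]]; rewrite evens_join odds_join D1 D2.
  have : dist_rho u (pts1 (w t.+1)) x < 2 ^- t.+1 := xw t.+1.
  rewrite -subr_gt0 => /(points_dense fe2 loc2 x)[n nx].
  have lt_d : dist_rho u (pts1 (w t.+1)) (pts2 n) < toR (2 ^- t.+1).
    rewrite ratr_exp2; apply: le_lt_trans (dist_rho_triangle u _ x _) _.
    by rewrite [dist_rho u x _]dist_rhoC; lra.
  have [s sP] := lt_chk_complete (locates_approx loc1 _) (locates_approx loc2 _) lt_d.
  by exists (pr n s); rewrite !prE.
have [c cP] : cmp Q (fun O t => p1 (F O t)) by apply: cmp_p1.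
exists c => x w xw; have QO : Q (join D w) by exists x, w.
exists (fun t => p1 (F (join D w) t)); first exact: cP.
move=> t; have := FP _ t QO; rewrite evens_join odds_join D1 D2.
move=> /(lt_chk_sound (locates_approx loc1 _) (locates_approx loc2 _)).
rewrite ratr_exp2 => h1.
have h2 : dist_rho u (pts1 (w t.+1)) x < 2 ^- t.+1 := xw t.+1.
suff : dist_rho u (pts2 (p1 (F (join D w) t))) x < 2 ^- t by [].
apply: le_lt_trans (dist_rho_triangle u _ (pts1 (w t.+1)) _) _.
by rewrite [dist_rho u (pts2 _) _]dist_rhoC; have := @exp2S R t; lra.
Qed.

End Presentation.

(** * Total boundedness and assembly of the algorithm *)

(** A list of states is directly a list of indices of points: [pts i] lies in state [i], and a
    covering state that contains [x] lies within [2 ^- j] of [x]. *)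
Lemma cover_search (R : realType) (X : topologicalType) (dist : X -> X -> R) :
  [set: X] !=set0 -> compact [set: X] -> compatible_metric dist ->
  exists2 h, cmp (good R X) h &
  forall (u : nat -> continuousType X (R[i]^o)) f e pts val,
    is_algebra_presentation u -> input_names u f e -> locates val u f e pts ->
    total_boundedness_function (space_of (SpacePresentation (dist_rho u) pts))
      (h (join f e)).
Proof.
move=> X_nonempty X_compact dist_compat.
have [|O j [u [f [e [u_pres [f_name e_name] ->]]]]|w cw wP] := @cmp_search (good R X)
  (fun O j w => cover_chk (evens O) (odds O) j w).
- by cmp_auto.
- rewrite evens_join odds_join.
  exact: (cover_chk_complete X_nonempty X_compact dist_compat u_pres f_name).
exists (fun O j => p1 (w O j)); first exact: cmp_p1.
move=> u f e pts val u_pres fe pts_loc j x; have [f_name e_name] := fe.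
have := wP (join f e) j; rewrite evens_join odds_join => /(_ _)wj.
have [|i il [_ Vi]] := cover_chk_sound X_compact f_name x e_name (wj _).
  by exists u, f, e.
by exists i => //; apply: Vi; have [] := pts_loc i.
Qed.

Theorem theorem5p1 (R : realType) (X : topologicalType)
    (X_nonempty : [set: X] !=set0) (X_compact : compact [set: X])
    (X_polish : polish R X) :
  exists (Phi : functional)
         (Xp : (nat -> continuousType X (R[i]^o)) ->
               (nat -> nat) -> (nat -> nat) -> space_presentation R X),
    (forall (u : nat -> continuousType X (R[i]^o)) (f e : nat -> nat),
       is_algebra_presentation u -> input_names u f e ->
       exists g h : nat -> nat,
         [/\ computes Phi (join f e) (join g h),
             is_space_presentation (Xp u f e),
             metric_name (space_of (Xp u f e)) g,
             total_boundedness_function (space_of (Xp u f e)) h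
           & evaluative (join f e) u (Xp u f e)]) /\
    (forall (u : nat -> continuousType X (R[i]^o)) (f1 e1 f2 e2 : nat -> nat),
       is_algebra_presentation u ->
       input_names u f1 e1 -> input_names u f2 e2 ->
       computably_homeomorphic_id (join (join f1 e1) (join f2 e2))
         (Xp u f1 e1) (Xp u f2 e2)).
Proof.
have [_ [dist dist_compat _]] := X_polish.
have [val val_cmp valP] := points_exist X_nonempty X_compact dist_compat.
have [h h_cmp hP] := cover_search X_nonempty X_compact dist_compat.
have [x0 _] := X_nonempty.
pose pts (u : nat -> continuousType X (R[i]^o)) f e n :=
  xget x0 [set x | ratr (st_r f n) <= nrm (rho u (st_a f n) x) /\
    forall k s, nrm (rho u k x - qval (val (join f e) n k s)) < 2 ^- s].
have ptsP u f e : is_algebra_presentation u -> input_names u f e ->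
    locates val u f e (pts u f e).
  by move=> u_pres fe n; exact (xgetPex x0 (valP u f e u_pres fe n)).
(* The two outputs are interleaved exactly as in [join]. *)
have [Phi PhiP] : cmp (good R X) (fun O n =>
    if odd n then h O n./2 else diagram val O n./2).
  apply: cmp_if; cmp_auto; first by apply: (@cmp_comp _ h); cmp_auto.
  by apply: (@cmp_comp _ (diagram val)); cmp_auto; exact: cmp_diagram.
exists Phi, (fun u f e => SpacePresentation (dist_rho u) (pts u f e)); split.
  move=> u f e u_pres fe; have loc := ptsP u f e u_pres fe.
  exists (diagram val (join f e)), (h (join f e)); split.
  - by apply: PhiP; exists u, f, e.
  - exact: (presentation_is X_compact dist_compat u_pres fe loc).
  - exact: (diagram_name loc).
  - exact: (hP u f e _ val).
  - exact: (evaluation X_compact val_cmp u_pres fe loc).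
move=> u f1 e1 f2 e2 u_pres fe1 fe2.
have loc1 := ptsP u f1 e1 u_pres fe1; have loc2 := ptsP u f2 e2 u_pres fe2.
have c_evens P : cmp P evens by cmp_auto.
have c_odds P : cmp P odds by cmp_auto.
split.
  by apply: (name_translation X_compact dist_compat val_cmp u_pres fe1 fe2 loc1 loc2
    c_evens c_odds); rewrite ?evens_join ?odds_join.
by apply: (name_translation X_compact dist_compat val_cmp u_pres fe2 fe1 loc2 loc1
    c_odds c_evens); rewrite ?evens_join ?odds_join.
Qed.
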